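(* Let $G$ be a locally compact, second countable, Hausdorff, unimodular group and let $\mathrm{Del}_*$ be the space of Delone sets in $G$ with fixed parameters. Let $\Omega\in\mathcal{I}_G(\mathrm{Del}_* )$ be a uniquely ergodic Delone dynamical system with invariant measure $\mu$. If $(\Omega_l,\mu_l,G)$, $l\in\mathbb{N}$, are Delone dynamical systems in $\mathcal{I}_G(\mathrm{Del}_* )$ such that $\Omega_l\to\Omega$ in the Chabauty-Fell topology, then $$\lim_{l\to\infty}\gamma_{\Omega_l,\mu_l}=\gamma_{\Omega,\mu}$$ in the weak-$*$ topology of Radon measures on $G$.
   Context: Chabauty-Fell topology: for a locally compact, second countable, Hausdorff space $Z$, the set $\mathcal{C}(Z)$ of closed subsets of $Z$ carries the topology with basis $\{Y\in\mathcal{C}(Z): C\cap Y=\emptyset,\ O\cap Y\ne\emptyset\ \forall O\in\mathcal{O}\}$, $C\subseteq Z$ compact, $\mathcal{O}$ a finite family of open sets. Fix an open neighborhood $U$ of the identity $e\in G$ and a compact $K\subseteq G$. $\mathrm{Del}_*$ is the set of non-empty $D\subseteq G$ with $\#(gU\cap D)\le1$ for all $g\in G$ and $D\cdot K=G$; it is a compact subspace of $\mathcal{C}(G)$ on which $G$ acts by left translation. $\mathcal{I}_G(\mathrm{Del}_* )$ is the set of non-empty, closed, $G$-invariant subsets of $\mathrm{Del}_*$ with the topology induced from $\mathcal{C}(\mathrm{Del}_* )$. A Delone dynamical system $(\Omega,\mu,G)$ is such an $\Omega$ together with a $G$-invariant Borel probability measure $\mu$ on $\Omega$; $\Omega$ is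 uniquely ergodic if it carries exactly one such measure. For $f\in C_c(G)$ and $D\in\mathrm{Del}_*$ let $\mathcal{P}f(D):=\sum_{x\in D}f(x)$. Put $f^*(g)=\overline{f(g^{-1})}$ and $(f_1*f_2)(g)=\int_G f_1(h)f_2(h^{-1}g)\,dm_G(h)$, $m_G$ the Haar measure. The autocorrelation $\gamma_{\Omega,\mu}$ is the unique positive definite Radon measure on $G$ with $\gamma_{\Omega,\mu}(f_1^**f_2)=\int_\Omega\overline{\mathcal{P}f_1(D)}\,\mathcal{P}f_2(D)\,d\mu(D)$ for all $f_1,f_2\in C_c(G)$. Weak-$*$ convergence of Radon measures on $G$ means convergence of integrals against all functions in $C_c(G)$. *)

(* Defs.v *)
From HB Require Import structures.
From mathcomp Require Import all_boot all_order all_algebra.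
From mathcomp Require Import all_classical all_reals all_analysis.
From mathcomp Require Export complex.

Set Implicit Arguments.
Unset Strict Implicit.
Unset Printing Implicit Defensive.

Import Order.TTheory GRing.Theory Num.Theory.
Import numFieldNormedType.Exports.

Local Open Scope classical_set_scope.
Local Open Scope ring_scope.
Local Open Scope complex_scope.

(* R[i] carries the topology of its complex modulus. *)
HB.instance Definition _ (R : rcfType) := PseudoPointedMetric.copy R[i] R[i]^o.
HB.instance Definition _ (R : rcfType) := NormedModule.copy R[i] R[i]^o.

HB.mixin Record isTopologicalGroup G of Group G & PointedTopological G := {
  mulg_continuous : continuous (fun p : G * G => (p.1 * p.2)%g) ;
  invg_continuous : continuous (fun x : G => (x^-1)%g)
}.

(* The distinguished point comes from the requirement, in the library, that
   measurable spaces be pointed; it plays no role. *)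
#[short(type="topologicalGroupType")]
HB.structure Definition TopologicalGroup :=
  {G of Group G & PointedTopological G & isTopologicalGroup G}.

Notation borel T := (g_sigma_algebraType (@open T)).

Section ChabautyFell.
Context (Z : topologicalType).

Record closed_subset := ClosedSubset {
  closed_subset_set :> set Z ;
  closed_subsetP : closed closed_subset_set }.

HB.instance Definition _ := gen_eqMixin closed_subset.
HB.instance Definition _ := gen_choiceMixin closed_subset.
HB.instance Definition _ :=
  isPointed.Build closed_subset (ClosedSubset (@closed0 Z)).

Definition chabauty_basic (C : set Z) (Os : set (set Z)) : set closed_subset :=
  [set Y | C `&` Y = set0 /\ forall O, Os O -> O `&` Y !=set0].

Definition chabauty_open : set (set closed_subset) :=
  [set W | forall Y, W Y -> exists C Os,
    [/\ compact C, finite_set Os, Os `<=` open,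
        chabauty_basic C Os Y & chabauty_basic C Os `<=` W]].

Let chabauty_openT : chabauty_open setT.
Proof.
move=> Y _; exists set0, set0; split=> //.
- exact: compact0.
- by split; [rewrite set0I|].
Qed.

Let chabauty_openI : setI_closed chabauty_open.
Proof.
move=> V W oV oW Y [/oV[C [P [cC fP oP [CY PY] CPV]]]].
move=> /oW[D [Q [cD fQ oQ [DY QY] DQW]]].
exists (C `|` D), (P `|` Q); split.
- exact: compactU.
- by rewrite finite_setU.
- by move=> O [/oP|/oQ].
- split; first by rewrite setIUl CY DY setU0.
  by move=> O [/PY|/QY].
- move=> X [+ PQX]; rewrite setIUl setU_eq0 => -[CX DX].
  split; [apply: CPV|apply: DQW]; split=> // O ?; apply: PQX; by [left|right].
Qed.

Let chabauty_open_bigU (I : Type) (f : I -> set closed_subset) :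
  (forall i, chabauty_open (f i)) -> chabauty_open (\bigcup_i f i).
Proof.
move=> of_ Y [i _ /of_[C [P [cC fP oP CPY CPf]]]].
by exists C, P; split=> // X /CPf fX; exists i.
Qed.

HB.instance Definition _ := isOpenTopological.Build closed_subset
  chabauty_openT chabauty_openI chabauty_open_bigU.

End ChabautyFell.

Section Measures.
Context {R : realType}.
Local Open Scope ereal_scope.

Definition Cintegral d (T : measurableType d) (m : {measure set T -> \bar R})
    (D : set T) (f : T -> R[i]) : R[i] :=
  ((\int[m]_(x in D) complex.Re (f x))%R +i*
   (\int[m]_(x in D) complex.Im (f x))%R)%C.

Definition radon (T : ptopologicalType)
    (m : {measure set (borel T) -> \bar R}) : Prop :=
  [/\ forall K : set T, compact K -> m K < +oo,
      forall A : set (borel T), measurable A ->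
        m A = ereal_inf [set m V | V in [set V : set T | open V /\ A `<=` V]] &
      forall V : set T, open V ->
        m V = ereal_sup [set m K | K in [set K : set T | compact K /\ K `<=` V]]].

Context {G : topologicalGroupType}.
Implicit Types m : {measure set (borel G) -> \bar R}.

Definition left_haar m : Prop :=
  [/\ radon m, m [set: G] != 0 &
      forall (g : G) (A : set (borel G)), measurable A ->
        m ((fun x : G => (g * x)%g) @^-1` A) = m A].

End Measures.

Section GroupFunctions.
Context {R : realType} {G : topologicalGroupType}.
Implicit Types (m : {measure set (borel G) -> \bar R}) (f : G -> R[i]).

Definition unimodular : Prop :=
  forall m, left_haar m ->
    forall (g : G) (A : set (borel G)), measurable A ->
      m ((fun x : G => (x * g)%g) @^-1` A) = m A.

Definition Cc : set (G -> R[i]) :=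
  [set f | continuous f /\ compact (closure [set x | f x != 0])].

Definition star f : G -> R[i] := fun g => ((f (g^-1)%g)^*)%C.

Definition convolution m f1 f2 : G -> R[i] :=
  fun g => Cintegral m setT (fun h => f1 h * f2 (h^-1 * g)%g).

Definition positive_definite (mG m : {measure set (borel G) -> \bar R}) : Prop :=
  forall f, Cc f -> 0 <= Cintegral m setT (convolution mG (star f) f).

Definition weak_star_cvg (m_ : nat -> {measure set (borel G) -> \bar R}) m :
    Prop :=
  forall f, Cc f ->
    (fun l => Cintegral (m_ l) setT f) @ \oo --> Cintegral m setT f.

End GroupFunctions.
Arguments unimodular R G : clear implicits.

Section Delone.
Context {G : topologicalGroupType}.
Implicit Types D : closed_subset G.

(* Restricting to closed sets loses nothing: when U is an open neighbourhood
   of 1 and G is Hausdorff, the second condition makes D closed. *)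
Definition Del (U K : set G) : set (closed_subset G) :=
  [set D : closed_subset G |
    [/\ D !=set0,
        forall g : G, is_subset1 ([set (g * u)%g | u in U] `&` D) &
        [set (d * k)%g | d in D & k in K] = setT]].

Lemma closed_translate (g : G) D : closed [set (g * x)%g | x in D].
Proof.
have -> : [set (g * x)%g | x in D] = (fun x => (g^-1 * x)%g) @^-1` D.
  apply/seteqP; split=> [_ [x Dx <-]|x Dx] /=; first by rewrite mulKg.
  by exists (g^-1 * x)%g => //; rewrite mulVKg.
apply: preimage_closed; last exact: closed_subsetP.
move=> x _; apply: (@continuous_comp _ (G * G)%type _
  (fun x => (g^-1%g, x)) (fun p => (p.1 * p.2)%g)).
  by apply: cvg_pair => //; exact: cvg_cst.
exact: mulg_continuous.
Qed.

Definition translate (g : G) D : closed_subset G :=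
  ClosedSubset (closed_translate (g := g) (D := D)).

Section Systems.
Context {U K : set G}.

(* A closed set of elements of the subspace [Del U K], seen in C(G). *)
Definition in_ambient (W : closed_subset (Del U K)) : set (closed_subset G) :=
  [set set_val D | D in (W : set (Del U K))].

Definition invariant_subset (W : closed_subset (Del U K)) : Prop :=
  forall (g : G) D, in_ambient W D -> in_ambient W (translate g D).

End Systems.

Definition IG (U K : set G) : set (closed_subset (Del U K)) :=
  [set W : closed_subset (Del U K) | W !=set0 /\ invariant_subset W].
Arguments IG : clear implicits.

Definition carrier (U K : set G) (Omega : IG U K) : set (closed_subset G) :=
  in_ambient (set_val Omega).

(* A Borel probability measure on Omega is represented by its extension by
   zero to C(G). *)
Definition invariant_probability {R : realType} (U K : set G) (Omega : IG U K)
    (mu : probability (borel (closed_subset G)) R) : Prop :=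
  mu (carrier Omega) = 1%E /\
  forall (g : G) (A : set (borel (closed_subset G))), measurable A ->
    mu (translate g @^-1` A) = mu A.

Definition uniquely_ergodic (R : realType) (U K : set G) (Omega : IG U K) :
    Prop :=
  exists mu : probability (borel (closed_subset G)) R,
    invariant_probability Omega mu /\
    forall nu : probability (borel (closed_subset G)) R,
      invariant_probability Omega nu ->
      forall A : set (borel (closed_subset G)), measurable A -> nu A = mu A.

(* The sum has finitely many nonzero terms for f in Cc and D in Del U K. *)
Definition periodization {R : realType} (f : G -> R[i]) D : R[i] :=
  \sum_(x \in (D : set G)) f x.

Definition autocorrelation {R : realType}
    (mG : {measure set (borel G) -> \bar R}) (U K : set G) (Omega : IG U K)
    (mu : probability (borel (closed_subset G)) R)
    (gamma : {measure set (borel G) -> \bar R}) : Prop :=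
  [/\ radon gamma, positive_definite mG gamma &
      forall f1 f2 : G -> R[i], Cc f1 -> Cc f2 ->
        Cintegral gamma setT (convolution mG (star f1) f2) =
        Cintegral mu (carrier Omega)
          (fun D => (periodization f1 D)^*%C * periodization f2 D)].

End Delone.
Arguments IG {G} U K _.

(* Main.v *)
Require Import Defs.
From HB Require Import structures.
From mathcomp Require Import all_boot all_order all_algebra.
From mathcomp Require Import all_classical all_reals all_analysis.
From mathcomp Require Import measurable_realfun ring lra.
Set Implicit Arguments.
Unset Strict Implicit.
Unset Printing Implicit Defensive.
Import Order.TTheory GRing.Theory Num.Theory.
Import numFieldNormedType.Exports.
Local Open Scope classical_set_scope.
Local Open Scope ring_scope.

(** The measures gamma_ l are known through the convolutions f1^* * f2, on which
    they are integrals of products of periodizations against mu_ l.  The proof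
    therefore has two halves: the mu_ l converge to mu, and convergence on
    convolutions is enough.

    First half.  The space of all closed subsets of G is compact and Hausdorff,
    so every ultrafilter finer than the cofinite one gives the sequence mu_ l a
    limit: the set function F |-> lim mu_ l F on closed sets is a content, and
    its regularization is a Borel probability nu with nu O <= lim mu_ l O for
    open O ([content_extension], [ultralimit_content]).  Invariance passes to
    nu ([outer_ultralimit_invariant]).  A closed set disjoint from Omega is
    compact, hence is eventually disjoint from Omega_ l by the very definition
    of the Chabauty-Fell topology ([IG_cvg_miss]), so nu is carried by Omega.
    Unique ergodicity gives nu = mu for every ultrafilter.  Hence
    mu O <= liminf mu_ l O for open O ([Delone_liminf_open]), and integrals of
    functions continuous on the closed set of Delone sets converge
    ([Delone_cvg_Rintegral]).  Periodizations of test functions are such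
    functions ([Rperiodization_continuous]), because a Delone set close to D
    has exactly one point near each point of D, and no other point in a given
    compact set.

    Second half.  Let u be a test function on G and rho an approximate identity
    concentrated near 1.  Then rho * u is uniformly close to u, and both are
    supported in a fixed compact set, on which some convolution w is at least
    1/2.  So |rho * u - u| <= e w pointwise, and the integrals of w against
    gamma_ l are bounded since they converge ([weak_cvg_convolutions]).

    All of this is done for real functions.  The complex statement follows by
    splitting f into its real and imaginary parts, and by feeding real
    functions to the defining identity of the autocorrelation
    ([autocorrelation_real]). *)

(** * Extension of a content on the closed sets of a compact space *)

Section ProbabilityOfMeasure.
Context d (T : measurableType d) (R : realType).
Context (m : {measure set T -> \bar R}) (m1 : m setT = 1%E).

(** An alias carrying the proof of [m setT = 1], so that the probability
    structure can be attached to it. *)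
Definition total1 of m setT = 1%E := m : set T -> \bar R.

HB.instance Definition _ := Measure.copy (total1 m1) m.
HB.instance Definition _ := Measure_isProbability.Build d T R (total1 m1) m1.

Definition probability_of_measure : probability T R := total1 m1.

End ProbabilityOfMeasure.

Section ContentExtension.
Local Open Scope ereal_scope.
Context {R : realType} {X : ptopologicalType}.
Implicit Types (lam : set X -> R) (F H O A : set X).

Record closed_content lam : Prop := ClosedContent {
  content_le : forall F H, closed F -> closed H -> F `<=` H ->
    (lam F <= lam H)%R ;
  content_subadd : forall F H, closed F -> closed H ->
    (lam (F `|` H) <= lam F + lam H)%R ;
  content_add : forall F H, closed F -> closed H -> F `&` H = set0 ->
    lam (F `|` H) = (lam F + lam H)%R }.

(** On open sets this is the measure to be constructed; [outer_content] then
    extends it to all sets. *)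
Definition inner_content lam A : \bar R :=
  ereal_sup [set (lam F)%:E | F in [set F | closed F /\ F `<=` A]].

Definition outer_content lam A : \bar R :=
  ereal_inf [set inner_content lam O | O in [set O | open O /\ A `<=` O]].

Context (lam : set X -> R) (hlam : closed_content lam).
Context (hT2 : hausdorff_space X) (hcpt : compact [set: X]).

Local Notation inn := (inner_content lam).
Local Notation out := (outer_content lam).

Lemma content0 : lam set0 = 0%R.
Proof.
have := content_add hlam closed0 closed0 (setI0 _).
by rewrite setU0 => /eqP; rewrite -subr_eq0 opprD addNKr oppr_eq0 => /eqP.
Qed.

Lemma le_inner_content F A : closed F -> F `<=` A -> (lam F)%:E <= inn A.
Proof. by move=> cF FA; apply: ereal_sup_ubound; exists F. Qed.

Lemma inner_content_ge0 A : 0 <= inn A.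
Proof. by rewrite -[0]/(0%:E) -content0; exact: le_inner_content closed0 _. Qed.

Lemma inner_contentS A B : A `<=` B -> inn A <= inn B.
Proof.
move=> AB; apply: ge_ereal_sup => _ [F [cF FA] <-].
by apply: le_inner_content => //; exact: subset_trans AB.
Qed.

Lemma inner_contentT A : inn A <= (lam setT)%:E.
Proof.
apply: ge_ereal_sup => _ [F [cF FA] <-].
by rewrite lee_fin; apply: content_le.
Qed.

Lemma inner_content_fin A : inn A \is a fin_num.
Proof.
rewrite ge0_fin_numE ?inner_content_ge0//.
by rewrite (le_lt_trans (inner_contentT A)) ?ltry.
Qed.

Lemma inner_content_approx A (e : R) : (0 < e)%R ->
  exists F, [/\ closed F, F `<=` A & inn A <= (lam F)%:E + e%:E].
Proof.
move=> e0; have [_ [F [cF FA] <-]] :=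
  ub_ereal_sup_adherent e0 (inner_content_fin A).
by move=> /ltW; rewrite leeBlDr// => ?; exists F.
Qed.

(** Normality separates [F `\` A] from [F `\` B], which are disjoint; removing
    from F a neighbourhood of the one or of the other yields the two pieces. *)
Lemma content_split F A B : closed F -> open A -> open B -> F `<=` A `|` B ->
  exists F1 F2, [/\ closed F1, closed F2, F1 `<=` A, F2 `<=` B &
    F `<=` F1 `|` F2].
Proof.
move=> cF oA oB FAB.
have cFA : closed (F `\` A) by apply: closedI => //; exact: open_closedC.
have cFB : closed (F `\` B) by apply: closedI => //; exact: open_closedC.
have nX := compact_normal hT2 hcpt.
have [|U [V [oU oV FAU FBV UV0]]] := (@normal_openP R X).1 nX _ _ cFA cFB.
  rewrite -subset0 => x [[Fx nAx] [_ nBx]].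
  by case: (FAB _ Fx).
exists (F `\` U), (F `\` V); split.
- by apply: closedI => //; exact: open_closedC.
- by apply: closedI => //; exact: open_closedC.
- by move=> x [Fx nUx]; apply: contrapT => nAx; apply/nUx/FAU.
- by move=> x [Fx nUx]; apply: contrapT => nAx; apply/nUx/FBV.
- move=> x Fx; have [Ux|nUx] := pselect (U x); last by left.
  right; split=> // Vx.
  by suff : set0 x by []; rewrite -UV0.
Qed.

(** Finite subadditivity over open sets, by splitting off the part of F that
    lies in the last of them. *)
Lemma content_le_sum (O : (set X)^nat) n F : (forall i, open (O i)) ->
  closed F -> F `<=` \bigcup_(i < n) O i ->
  (lam F)%:E <= \sum_(0 <= i < n) inn (O i).
Proof.
move=> oO; elim: n F => [|n IH] F cF FO.
  have -> : F = set0.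
    by rewrite -subset0 => x /FO[j].
  by rewrite big_geq// content0.
have oU : open (\bigcup_(i < n) O i) by apply: bigcup_open.
have [|F1 [F2 [cF1 cF2 F1O F2O FF]]] := content_split cF oU (oO n).
  move=> x /FO[j /=]; rewrite ltnS leq_eqVlt => /predU1P[->|nj] Ojx.
    by right.
  by left; exists j.
rewrite big_nat_recr//=.
have : (lam F <= lam F1 + lam F2)%R.
  apply: le_trans (content_subadd hlam cF1 cF2).
  by apply: content_le => //; exact: closedU.
rewrite -lee_fin => /le_trans; apply; rewrite EFinD leeD//; first exact: IH.
exact: le_inner_content.
Qed.

(** Countable subadditivity reduces to finite subadditivity because a closed
    set inside the union is compact, hence inside a finite subunion. *)
Lemma inner_content_subadd (O : (set X)^nat) : (forall i, open (O i)) ->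
  inn (\bigcup_i O i) <= \sum_(i <oo) inn (O i).
Proof.
move=> oO; apply: ge_ereal_sup => _ [F [cF FO] <-].
have cptF : compact F by exact: (subclosed_compact cF hcpt).
have [n _ Fn] : \forall n \near \oo, F `<=` \bigcup_(i < n) O i.
  move/compact_near_coveringP : cptF; apply=> x /FO[k _ Okx].
  exists (O k, [set n | (k < n)%N]) => /=.
    by split; [exact: open_nbhs_nbhs|exact: nbhs_infty_gt].
  by move=> [y n] /= [Oky kn]; exists k.
have := @content_le_sum O n F oO cF (Fn n (leqnn n)).
move=> /le_trans; apply.
by apply: nneseries_lim_ge => k _ _; exact: inner_content_ge0.
Qed.

Lemma outer_content_open O : open O -> out O = inn O.
Proof.
move=> oO; apply/eqP; rewrite eq_le; apply/andP; split.
  by apply: ereal_inf_lbound; exists O; split.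
by apply: le_ereal_inf_tmp => _ [V [oV OV] <-]; exact: inner_contentS.
Qed.

Lemma outer_contentS A B : A `<=` B -> out A <= out B.
Proof.
move=> AB; apply: ereal_inf_le_tmp => _ [V [oV BV] <-].
by exists V; split => //; exact: subset_trans BV.
Qed.

Lemma outer_content_ge0 A : 0 <= out A.
Proof. by apply: le_ereal_inf_tmp => _ [V _ <-]; exact: inner_content_ge0. Qed.

Lemma outer_content_fin A : out A \is a fin_num.
Proof.
rewrite ge0_fin_numE ?outer_content_ge0//.
rewrite (@le_lt_trans _ _ (inn setT))//; last first.
  by rewrite (le_lt_trans (inner_contentT _)) ?ltry.
by rewrite -outer_content_open//; [exact: outer_contentS|exact: openT].
Qed.

Lemma outer_content_approx A (e : R) : (0 < e)%R ->
  exists O, [/\ open O, A `<=` O & inn O <= out A + e%:E].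
Proof.
move=> e0; have [_ [V [oO AO] <-]] :=
  lb_ereal_inf_adherent e0 (outer_content_fin A).
by move=> /ltW ?; exists V.
Qed.

Lemma outer_content_sigma_subadditive : sigma_subadditive out.
Proof.
move=> A; apply/lee_addgt0Pr => e e0.
apply: le_trans (epsilon_trick _ _ (ltW e0)); last first.
  by move=> n; exact: outer_content_ge0.
have e2 n : (0 < e / (2 ^ n.+1)%:R)%R by rewrite divr_gt0// ltr0n expn_gt0.
have /choice[V VP] n := @outer_content_approx (A n) _ (e2 n).
apply: (@le_trans _ _ (inn (\bigcup_n V n))).
  apply: ereal_inf_lbound; exists (\bigcup_n V n) => //; split.
    by apply: bigcup_open => n _; case: (VP n).
  by move=> x [n _ Anx]; exists n => //; case: (VP n) => _ + _; exact.
apply: le_trans.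
  by apply: inner_content_subadd => n; case: (VP n).
by apply: lee_nneseries => [n _ _|n _]; [exact: inner_content_ge0|case: (VP n)].
Qed.

Lemma outer_content0 : out set0 = 0.
Proof.
rewrite outer_content_open; last exact: open0.
apply/eqP; rewrite eq_le inner_content_ge0 andbT.
apply: ge_ereal_sup => _ [F [cF F0] <-].
by move: F0; rewrite subset0 => ->; rewrite content0.
Qed.

(** The outer measure [outer_content lam] makes open sets measurable: if A lies
    in V open, approximate [V `&` O] from inside by a closed F and [V `\` F] by
    a closed H; F and H are disjoint, so their contents add up below V. *)
Lemma content_extension : lam setT = 1%R ->
  exists nu : probability (borel X) R,
    [/\ forall O, open O -> nu O = inn O & forall A, nu A = out A].
Proof.
move=> lam1.
pose om : outer_measure R X := HB.pack out
  (isOuterMeasure.Build R X out outer_content0 outer_content_ge0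
     outer_contentS outer_content_sigma_subadditive).
have openM O : open O -> om.-caratheodory O.
  move=> oO; apply: le_caratheodory_measurable => A.
  apply: le_ereal_inf_tmp => _ [V [oV AV] <-]; apply/lee_addgt0Pr => e e0.
  have e20 : (0 < e / 2)%R by rewrite divr_gt0.
  have [F [cF FVO hF]] := @inner_content_approx (V `&` O) _ e20.
  have oVF : open (V `\` F) by apply: openI => //; exact: closed_openC.
  have [H [cH HVF hH]] := @inner_content_approx (V `\` F) _ e20.
  have h1 : om (A `&` O) <= inn (V `&` O).
    by apply: ereal_inf_lbound; exists (V `&` O) => //; split;
      [exact: openI|exact: setSI].
  have h2 : om (A `&` ~` O) <= inn (V `\` F).
    apply: ereal_inf_lbound; exists (V `\` F) => //; split => //.
    by move=> x [/AV Vx nOx]; split=> // /FVO[].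
  apply: (le_trans (leeD (le_trans h1 hF) (le_trans h2 hH))).
  rewrite addeACA -!EFinD -splitr EFinD leeD2r// -content_add//; last first.
    by rewrite -subset0 => x [Fx /HVF[]].
  apply: le_inner_content; first exact: closedU.
  by rewrite subUset; split; [move=> x /FVO[]|move=> x /HVF[]].
have sub : (measurable : set (set (borel X))) `<=` om.-caratheodory.
  apply: smallest_sub => //; split.
  - exact: caratheodory_measurable_set0.
  - by move=> A mA; rewrite setTD; exact: caratheodory_measurable_setC.
  - by move=> F mF; exact: caratheodory_measurable_bigcup.
have sadd : semi_sigma_additive (out : set (borel X) -> \bar R).
  move=> F mF tF mU.
  apply: (@caratheodory_measure_sigma_additive R X om F) => //.
  - by move=> i; exact: sub.
  - exact: sub.
have outT : out [set: borel X] = 1.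
  rewrite outer_content_open; last exact: openT.
  apply/eqP; rewrite eq_le -lam1 inner_contentT/=.
  by apply: le_inner_content => //; exact: closedT.
pose m : {measure set (borel X) -> \bar R} := HB.pack
  (out : set (borel X) -> \bar R)
  (isMeasure.Build _ _ _ (out : set (borel X) -> \bar R)
     outer_content0 outer_content_ge0 sadd).
exists (probability_of_measure (m := m) outT); split=> [W oO|A//].
exact: outer_content_open.
Qed.

End ContentExtension.

(** * Ultralimits of probability measures *)

Section BorelSets.
Context {X : ptopologicalType}.

Lemma closed_borel (F : set X) : closed F -> measurable (F : set (borel X)).
Proof.
move=> cF; rewrite -[F]setCK; apply: measurableC.
by apply: sub_sigma_algebra; exact: closed_openC.
Qed.

Lemma open_borel (F : set X) : open F -> measurable (F : set (borel X)).
Proof. exact: sub_sigma_algebra. Qed.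

Lemma continuous_preimage_borel {Y : ptopologicalType} (t : X -> Y) (B : set Y) :
  continuous t -> measurable (B : set (borel Y)) ->
  measurable (t @^-1` B : set (borel X)).
Proof.
move=> ct mB.
have : measurable_fun (setT : set (borel X)) (t : borel X -> borel Y).
  apply: (@measurability _ _ _ _ _ _ (@open Y : set (set (borel Y)))) => //.
  move=> _ [V oV <-]; rewrite setTI; apply: open_borel.
  by apply: open_comp => // x _; exact: ct.
by move=> /(_ measurableT _ mB); rewrite setTI.
Qed.

End BorelSets.

Section UltraLimit.
Context {R : realType} {X : ptopologicalType}.
Context (UF : set_system nat) (hUF : UltraFilter UF).
Context (P_ : nat -> probability (borel X) R).

Let UFp : ProperFilter UF. Proof. exact: ultra_proper. Qed.
Existing Instance UFp.

Lemma ultra_cvg (x : nat -> R) : (forall n, x n \in `[0, 1]) ->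
  cvg (x @ UF).
Proof.
move=> x01.
have xF : (x @ UF) [set` `[0, 1]] by apply: (@filterE _ UF) => n; exact: x01.
have [p [_ cl]] := @segment_compact R 0 1 (x @ UF) _ xF.
apply/cvg_ex; exists p => V Vp.
have [//|/= nV] := in_ultra_setVsetC (x @^-1` V) hUF.
by have [y []] := cl (~` V) V nV Vp.
Qed.

(** Defined for all sets at once, this is finitely additive on Borel sets but
    in general not countably so: mass may escape from an open set to its
    boundary. *)
Definition ultralimit (F : set X) : R := lim (fine (P_ n F) @[n --> UF]).

Lemma ultralimit_cvg (F : set X) : measurable (F : set (borel X)) ->
  fine (P_ n F) @[n --> UF] --> ultralimit F.
Proof.
move=> mF; apply: ultra_cvg => n; rewrite in_itv/= fine_ge0//=.
rewrite -lee_fin fineK ?fin_num_measure//; exact: probability_le1.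
Qed.

Lemma ultralimit_content : closed_content ultralimit.
Proof.
split.
- move=> F H cF cH FH.
  have mF := closed_borel cF; have mH := closed_borel cH.
  apply: (ler_cvg_to (ultralimit_cvg mF) (ultralimit_cvg mH)).
  apply: nearW => n; rewrite fine_le ?fin_num_measure//.
  by apply: le_measure; rewrite ?inE.
- move=> F H cF cH.
  have mF := closed_borel cF; have mH := closed_borel cH.
  have mFH := measurableU _ _ mF mH.
  apply: (ler_cvg_to (ultralimit_cvg mFH)
    (cvgD (ultralimit_cvg mF) (ultralimit_cvg mH))).
  apply: nearW => n /=; rewrite fctE -fineD ?fin_num_measure//.
  rewrite fine_le ?fin_numD ?fin_num_measure//.
  exact: measureU2.
- move=> F H cF cH FH0.
  have mF := closed_borel cF; have mH := closed_borel cH.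
  have mFH := measurableU _ _ mF mH.
  apply: (cvg_unique _ (ultralimit_cvg mFH)) => //.
  rewrite (_ : (fun n => fine (P_ n (F `|` H))) =
    (fun n => fine (P_ n F) + fine (P_ n H))).
    exact: (cvgD (ultralimit_cvg mF) (ultralimit_cvg mH)).
  apply/funext => n; rewrite measureU//.
  by rewrite fineD ?fin_num_measure.
Qed.

Lemma ultralimitT : ultralimit setT = 1.
Proof.
rewrite /ultralimit; under eq_fun do rewrite probability_setT /=.
exact: lim_cst.
Qed.

(** The outer content is built from the values on closed sets by suprema and
    infima over closed and open sets, all of which a homeomorphism permutes. *)
Lemma outer_ultralimit_invariant (s t : X -> X) :
  continuous s -> continuous t -> cancel s t -> cancel t s ->
  (forall n (A : set (borel X)), measurable A -> P_ n (s @^-1` A) = P_ n A) ->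
  forall A : set X,
    outer_content ultralimit (s @^-1` A) = outer_content ultralimit A.
Proof.
(* One inequality suffices, since it can be applied to the inverse as well. *)
suff le s1 t1 : continuous s1 -> continuous t1 -> cancel s1 t1 ->
    cancel t1 s1 ->
    (forall n (A : set (borel X)), measurable A -> P_ n (s1 @^-1` A) = P_ n A) ->
    forall A : set X,
    (outer_content ultralimit (s1 @^-1` A) <= outer_content ultralimit A)%E.
  move=> cs ct st ts inv A; apply/eqP; rewrite eq_le (le s t)//=.
  rewrite -{1}(_ : t @^-1` (s @^-1` A) = A); last first.
    by apply/seteqP; split=> x /=; rewrite ts.
  apply: (le t s) => // n B mB.
  have ct' : measurable (t @^-1` B : set (borel X)).
    exact: continuous_preimage_borel mB.
  rewrite -(inv n _ ct'); congr (P_ n _).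
  by apply/seteqP; split=> x /=; rewrite st.
move=> cs ct st ts inv A.
apply: le_ereal_inf_tmp => _ [V [oV AV] <-].
apply: (@le_trans _ _ (inner_content ultralimit (s1 @^-1` V))).
  apply: ereal_inf_lbound; exists (s1 @^-1` V) => //; split.
    by apply: open_comp => // x _; exact: cs.
  by move=> x /= /AV.
apply: ge_ereal_sup => _ [F [cF FV] <-].
have cF' : closed (t1 @^-1` F) by apply: preimage_closed => // x _; exact: ct.
apply: ereal_sup_ubound; exists (t1 @^-1` F).
  by split=> // x /= /FV /=; rewrite ts.
congr EFin; congr (lim _).
congr (_ @ UF); apply/funext => n; congr fine.
rewrite -(inv n (t1 @^-1` F)); last exact: closed_borel.
congr (P_ n _).
by apply/seteqP; split=> x /=; rewrite st.
Qed.

End UltraLimit.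

Section UniqueLimit.
Context {R : realType} {X : ptopologicalType}.
Context (hT2 : hausdorff_space X) (hcpt : compact [set: X]).
Context (P_ : nat -> probability (borel X) R) (P : probability (borel X) R).

(** If the inequality failed infinitely often, an ultrafilter concentrated on
    the bad indices would produce a limit measure different from P: its value
    at O is a supremum of ultralimits of closed subsets of O, hence at most
    [fine (P O) - e]. *)
Lemma liminf_open_of_unique_limit :
  (forall UF : set_system nat, UltraFilter UF -> \oo `<=` UF ->
    forall nu : probability (borel X) R,
    (forall A, nu A = outer_content (ultralimit UF P_) A) ->
    (forall O, open O -> nu O = inner_content (ultralimit UF P_) O) ->
    forall A : set (borel X), measurable A -> nu A = P A) ->
  forall (O : set X) (e : R), open O -> 0 < e ->
  \forall n \near \oo, fine (P O) <= fine (P_ n O) + e.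
Proof.
move=> uniq O e oO e0.
pose B := [set n | fine (P O) <= fine (P_ n O) + e].
have [//|nB] := pselect (\oo B).
have pF : ProperFilter (within (~` B) \oo).
  apply: Build_ProperFilter_ex => C CB; apply: contrapT => nC; apply: nB.
  move: CB; rewrite /within/=; apply: filterS => n Cn.
  apply: contrapT => nBn; apply: nC.
  by exists n; exact: Cn.
have [UF [hUF UFB]] := ultraFilterLemma pF.
have UFp : ProperFilter UF by exact: ultra_proper.
have ooUF : \oo `<=` UF.
  by move=> C ooC; apply: UFB; apply: filterS ooC => n Cn _.
have UFnB : UF (~` B) by apply: UFB; exact: nearW.
have [nu [nuO nuA]] := content_extension (ultralimit_content hUF P_) hT2 hcpt
  (ultralimitT hUF P_).
have PO : P O = inner_content (ultralimit UF P_) O.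
  by rewrite -nuO// (uniq UF hUF ooUF nu)//; exact: open_borel.
suff : (P O <= (fine (P O) - e)%:E)%E.
  rewrite -[in X in (X <= _)%E](@fineK _ (P O)) ?fin_num_measure//; last first.
    exact: open_borel.
  by rewrite lee_fin; lra.
rewrite [in X in (X <= _)%E]PO; apply: ge_ereal_sup => _ [F [cF FO] <-].
rewrite lee_fin.
have mF := closed_borel cF; have mO := open_borel oO.
apply: (limr_le (cvgP _ (ultralimit_cvg hUF mF))).
apply: filterS UFnB => n /= /negP; rewrite -ltNge => h.
have : fine (P_ n F) <= fine (P_ n O).
  rewrite fine_le ?fin_num_measure//.
  by apply: le_measure; rewrite ?inE.
by move=> ?; lra.
Qed.

End UniqueLimit.

(** * Convergence of integrals from the inequality on open sets *)

Section WithinContinuous.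
Context {R : realType} {X : ptopologicalType}.
Context (S : set X) (g : X -> R) (cg : {within S, continuous g}).

Lemma within_preimage_open (V : set R) : open V ->
  exists2 W, open W & S `&` g @^-1` V = S `&` W.
Proof.
move=> oV; have /continuousP/(_ _ oV) := cg.
move=> /open_subspaceP[W oW WS]; exists W => //.
by rewrite [RHS]setIC WS setIC.
Qed.

Lemma within_continuous_measurable : closed S ->
  measurable_fun (S : set (borel X)) g.
Proof.
move=> cS; apply: (measurability _ (RGenOInfty.measurableE R)).
move=> _ [_ [x ->] <-].
have [|W oW ->] := @within_preimage_open [set` `]x, +oo[%R].
  exact: interval_open.
by apply: measurableI; [exact: closed_borel|exact: open_borel].
Qed.

Lemma within_continuous_bounded : compact S ->
  exists2 M, 0 < M & forall x, S x -> `|g x| <= M.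
Proof.
move=> cS; have /compact_bounded[M [_ hM]] := continuous_compact cg cS.
exists (`|M| + 1) => [|x Sx]; first by rewrite ltr_wpDl.
by apply: hM; [rewrite (le_lt_trans (ler_norm _))// ltrDl|exists x].
Qed.

End WithinContinuous.

Lemma bounded_integrable d (T : measurableType d) (R : realType)
    (m : {measure set T -> \bar R}) (D : set T) (g : T -> R) (M : R) :
  measurable D -> (m D < +oo)%E -> measurable_fun D g ->
  (forall x, D x -> `|g x| <= M) -> m.-integrable D (EFin \o g).
Proof.
move=> mD mDoo mg gM; apply: measurable_bounded_integrable => //.
exists M; split; first exact: num_real.
by move=> x Mx t /= /gM /le_trans; apply; exact: ltW.
Qed.

(** The sum counts the integers in [1, x[, so it is x rounded down, or x - 1
    when x is a positive integer. *)
Lemma step_bounds (R : realType) (n : nat) (x : R) : 0 <= x <= n%:R ->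
  (\sum_(i < n) (i.+1%:R < x)%R%:R <= x) /\
  (x <= \sum_(i < n) (i.+1%:R < x)%R%:R + 1).
Proof.
elim: n => [|n IH] /andP[x0 xn].
  by rewrite !big_ord0; split=> //; lra.
rewrite !big_ord_recr/= (ltNge _ x) xn /= addr0.
have [xn'|nx] := leP x n%:R; first by apply: IH; rewrite x0.
suff -> : \sum_(i < n) (i.+1%:R < x)%R%:R = n%:R :> R.
  by split; [exact: ltW|rewrite natr1].
rewrite (eq_bigr (fun=> 1)) ?sumr_const ?card_ord// => k _.
by rewrite (le_lt_trans _ nx)// ler_nat.
Qed.

Lemma Rintegral_sum_indic d (T : measurableType d) (R : realType)
    (m : {measure set T -> \bar R}) (D : set T) (A : nat -> set T) n :
  measurable D -> (m D < +oo)%E -> (forall i, measurable (A i)) ->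
  m.-integrable D (EFin \o (fun x => \sum_(i < n) \1_(A i) x)) /\
  (\int[m]_(x in D) (\sum_(i < n) \1_(A i) x) =
    \sum_(i < n) fine (m (A i `&` D)))%R.
Proof.
move=> mD mDoo mA.
have iA i : m.-integrable D (EFin \o \1_(A i)).
  apply: (@bounded_integrable _ _ _ _ _ _ 1) => // x _.
  by rewrite indicE; case: (_ \in _); rewrite ?normr1 ?normr0.
elim: n => [|n [iS IH]].
  split.
    apply: (@bounded_integrable _ _ _ _ _ _ 0) => //.
      by under eq_fun do rewrite big_ord0; exact: measurable_cst.
    by move=> x _; rewrite big_ord0 normr0.
  rewrite big_ord0; under eq_Rintegral do rewrite big_ord0.
  by rewrite Rintegral_cst// mul0r.
pose s x : R := \sum_(i < n) \1_(A i) x.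
have -> : (fun x => \sum_(i < n.+1) \1_(A i) x : R) =
    (fun x => s x + \1_(A n) x : R).
  by apply/funext => x; rewrite big_ord_recr.
split; first exact: (integrableD mD iS (iA n)).
by rewrite RintegralD// IH big_ord_recr/= /Rintegral integral_indic.
Qed.

Section Portmanteau.
Context {R : realType} {X : ptopologicalType}.
Context (P_ : nat -> probability (borel X) R) (P : probability (borel X) R).
Context (liminf_open : forall (O : set X) (e : R), open O -> 0 < e ->
  \forall n \near \oo, fine (P O) <= fine (P_ n O) + e).
Context (S : set X) (cptS : compact S) (cS : closed S).
Context (PS : P S = 1%E) (P_S : forall n, P_ n S = 1%E).

Let mS : measurable (S : set (borel X)). Proof. exact: closed_borel. Qed.

Let Soo (Q : probability (borel X) R) : (Q S < +oo)%E.
Proof. by rewrite (le_lt_trans (probability_le1 Q mS))// ltry. Qed.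

(** This is how relatively open subsets of S enter: adding the null set [~` S]
    to one of them gives an open set of the whole space. *)
Let probability_setI (Q : probability (borel X) R) (A : set (borel X)) :
  Q S = 1%E -> measurable A -> Q (A `&` S) = Q (A `|` ~` S).
Proof.
move=> QS mA; have QCS : Q (~` S) = 0%E.
  by rewrite probability_setC// QS subee.
apply/eqP; rewrite eq_le; apply/andP; split.
  apply: le_measure; rewrite ?inE.
  - exact: measurableI.
  - by apply: measurableU => //; exact: measurableC.
  - by move=> x [Ax _]; left.
have -> : A `|` ~` S = (A `&` S) `|` ~` S.
  apply/seteqP; split=> x.
    by move=> [Ax|]; [have [?|?] := pselect (S x); [left|right]|right].
  by move=> [[]|]; [left|right].
have mAS := measurableI _ _ mA mS; have mCS := measurableC mS.
have : (Q (A `&` S `|` ~` S) <= Q (A `&` S) + Q (~` S))%E.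
  exact: measureU2.
by rewrite QCS adde0.
Qed.

(** Approximate g within 1/N by (1/N) times the sum of the indicators of the
    superlevel sets [g > i/N], to each of which [liminf_open] applies. *)
Lemma liminf_Rintegral01 (g : X -> R) (e : R) : {within S, continuous g} ->
  (forall x, S x -> 0 <= g x <= 1) -> 0 < e ->
  \forall n \near \oo,
    (\int[P]_(x in S) g x <= \int[P_ n]_(x in S) g x + e)%R.
Proof.
move=> cg g01 e0.
(* The step functions cost 1/N < e/2 and the superlevel sets another e/2. *)
pose N := (Num.trunc (2 / e)).+1.
have N0 : 0 < N%:R :> R by rewrite ltr0n.
have Ne : N%:R^-1 < e / 2.
  by rewrite -[e / 2]invrK ltf_pV2 ?posrE ?invr_gt0 ?divr_gt0//
     invf_div truncnS_gt.
have mg := within_continuous_measurable cg cS.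
have ig (Q : probability (borel X) R) : Q.-integrable S (EFin \o g).
  apply: (bounded_integrable (M := 1) mS (Soo _)) => // x /g01/andP[g0 g1].
  by rewrite ger0_norm.
have /choice[W WP] i : exists W, open W /\
    S `&` [set x | i.+1%:R < N%:R * g x] = S `&` W.
  have [W oW SW] := within_preimage_open cg (open_gt (y := i.+1%:R / N%:R)).
  exists W; split=> //; rewrite -SW; congr (_ `&` _).
  by apply/seteqP; split=> x /=; rewrite ltr_pdivrMr// mulrC.
have oW i : open (W i) by case: (WP i).
have mW i : measurable (W i : set (borel X)) by exact: open_borel.
have stepE x : S x -> \sum_(i < N) \1_(W i) x =
    \sum_(i < N) (i.+1%:R < N%:R * g x)%R%:R :> R.
  move=> Sx; apply: eq_bigr => i _; rewrite indicE; congr (_ %:R).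
  congr nat_of_bool; apply/idP/idP => [/set_mem Wx|h].
    by have [] : (S `&` [set x | i.+1%:R < N%:R * g x]) x
      by case: (WP i) => _ ->.
  by apply/mem_set; have [] : (S `&` W i) x by case: (WP i) => _ <-.
have bnd x : S x -> \sum_(i < N) \1_(W i) x <= N%:R * g x /\
    N%:R * g x <= \sum_(i < N) \1_(W i) x + 1.
  move=> Sx; rewrite stepE//; apply: step_bounds.
  have /andP[g0 g1] := g01 _ Sx.
  by rewrite mulr_ge0// ler_piMr.
have iNg (Q : probability (borel X) R) :
    Q.-integrable S (EFin \o (fun x => N%:R * g x)).
  apply: (bounded_integrable (M := N%:R) mS (Soo _)) => //.
    by apply: measurable_funM => //; exact: measurable_cst.
  move=> x /g01/andP[g0 g1].
  by rewrite ger0_norm ?mulr_ge0// ler_piMr.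
have finePS : fine (P S) = 1 by rewrite PS.
have ub : N%:R * (\int[P]_(x in S) g x)%R <=
    \sum_(i < N) fine (P (W i `|` ~` S)) + 1.
  rewrite -(RintegralZl _ mS (ig _)).
  have [iW IW] := Rintegral_sum_indic N mS (Soo P) mW.
  under eq_bigr do rewrite -probability_setI//.
  have i1 : P.-integrable S (EFin \o (fun=> 1%R)).
    by apply: (bounded_integrable (M := 1) mS (Soo _)) => // x _; rewrite normr1.
  rewrite -IW; apply: (@le_trans _ _
    (\int[P]_(x in S) (\sum_(i < N) \1_(W i) x + 1))%R).
    apply: (le_Rintegral mS (iNg P) (integrableD mS iW i1)).
    by move=> x /bnd[].
  rewrite RintegralD//.
  rewrite Rintegral_cst//. by rewrite (_ : fine _ = 1) ?mulr1//; exact: finePS.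
have lb n : \sum_(i < N) fine (P_ n (W i `|` ~` S)) <=
    N%:R * (\int[P_ n]_(x in S) g x)%R.
  rewrite -(RintegralZl _ mS (ig _)).
  have [iW IW] := Rintegral_sum_indic N mS (Soo (P_ n)) mW.
  under eq_bigr do rewrite -probability_setI//.
  rewrite -IW.
  by apply: (le_Rintegral mS iW (iNg _)) => x /bnd[].
have e20 : 0 < e / 2 by rewrite divr_gt0.
have near_sum : \forall n \near \oo, forall i : 'I_N,
    fine (P (W i `|` ~` S)) <= fine (P_ n (W i `|` ~` S)) + e / 2.
  apply: filter_forall => i; apply: liminf_open => //.
  by apply: openU => //; exact: closed_openC.
apply: filterS near_sum => n hn.
rewrite -(ler_pM2l N0) mulrDr (le_trans ub)//.
have : \sum_(i < N) fine (P (W i `|` ~` S)) <=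
    \sum_(i < N) (fine (P_ n (W i `|` ~` S)) + e / 2).
  by apply: ler_sum => i _; exact: hn.
rewrite big_split/= sumr_const card_ord -mulr_natl.
have : 1 <= N%:R * (e / 2).
  by rewrite mulrC -ler_pdivrMr// div1r ltW.
have := lb n.
rewrite (_ : N%:R * e = N%:R * (e / 2) + N%:R * (e / 2)); last first.
  by rewrite -mulrDr -splitr.
by move=> h1 h2 h3; lra.
Qed.

(** The lower bound for g and for -g together give convergence; an affine
    change of variable brings a bounded function into [0, 1]. *)
Lemma cvg_Rintegral_within (g : X -> R) : {within S, continuous g} ->
  (\int[P_ n]_(x in S) g x)%R @[n --> \oo] --> (\int[P]_(x in S) g x)%R.
Proof.
suff half (f : X -> R) (e : R) : {within S, continuous f} -> 0 < e ->
    \forall n \near \oo,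
    (\int[P]_(x in S) f x <= \int[P_ n]_(x in S) f x + e)%R.
  move=> cg; apply/cvgrPdist_le => e e0.
  have cNg : {within S, continuous (fun x => - g x)}.
    by move=> x; apply: continuousN; exact: cg.
  have ig (Q : probability (borel X) R) : Q.-integrable S (EFin \o g).
    have [M M0 gM] := within_continuous_bounded cg cptS.
    apply: (bounded_integrable (M := M) mS (Soo _)) => //.
    exact: within_continuous_measurable.
  have IN (Q : probability (borel X) R) :
      (\int[Q]_(x in S) (- g x) = - \int[Q]_(x in S) g x)%R.
    under eq_Rintegral do rewrite -mulN1r.
    by rewrite (RintegralZl _ mS (ig Q)) mulN1r.
  near=> n.
  have h1 : (\int[P]_(x in S) g x <= \int[P_ n]_(x in S) g x + e)%R.
    by near: n; exact: half.
  have : (\int[P]_(x in S) (- g x) <= \int[P_ n]_(x in S) (- g x) + e)%R.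
    by near: n; exact: half.
  by rewrite !IN ler_norml => h2; apply/andP; split; lra.
move=> cf e0.
have [M M0 fM] := within_continuous_bounded cf cptS.
have if_ (Q : probability (borel X) R) : Q.-integrable S (EFin \o f).
  apply: (bounded_integrable (M := M) mS (Soo _)) => //.
  exact: within_continuous_measurable.
pose h x := (2 * M)^-1 * (f x + M).
have M20 : 0 < 2 * M by rewrite mulr_gt0.
have ch : {within S, continuous h}.
  move=> x; apply: (@continuousM _ (subspace S)).
    exact: cvg_cst.
  by apply: (@continuousD _ _ (subspace S)); [exact: cf|exact: cvg_cst].
have h01 x : S x -> 0 <= h x <= 1.
  move=> /fM; rewrite ler_norml => /andP[h1 h2]; rewrite /h.
  rewrite mulr_ge0 ?invr_ge0 ?(ltW M20)//=; last by lra.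
  by rewrite mulrC ler_pdivrMr// mul1r; lra.
have Ih (Q : probability (borel X) R) : Q S = 1%E ->
    (\int[Q]_(x in S) h x = (2 * M)^-1 * (\int[Q]_(x in S) f x + M))%R.
  move=> QS.
  have fineQS : fine (Q S) = 1 by rewrite QS.
  have iM : Q.-integrable S (EFin \o (fun=> M)).
    by apply: (bounded_integrable (M := `|M|) mS (Soo _)).
  rewrite (RintegralZl _ mS (integrableD mS (if_ Q) iM)).
  rewrite (RintegralD mS (if_ Q) iM) Rintegral_cst//.
  by rewrite (_ : fine _ = 1) ?mulr1//; exact: fineQS.
have e' : 0 < (2 * M)^-1 * e by rewrite mulr_gt0 ?invr_gt0.
apply: filterS (liminf_Rintegral01 ch h01 e') => n.
rewrite !Ih// -mulrDr ler_pM2l ?invr_gt0//.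
by move=> ?; lra.
Unshelve. all: by end_near. Qed.

End Portmanteau.

(** * The Chabauty-Fell space and its subspace of Delone sets *)

Section LocallyCompact.
Context {T : topologicalType}.
Context (hlc : locally_compact [set: T]) (hT2 : hausdorff_space T).

Lemma locally_compact_nbhs (R : realType) (x : T) (W : set T) : nbhs x W ->
  exists C, [/\ compact C, closed C, nbhs x C & C `<=` W].
Proof.
move=> xW; have [C0] := @hlc x Logic.I; rewrite withinET => xC0 [cC0 clC0].
have reg : regular_space T.
  apply: (@completely_regular_regular R).
  exact: locally_compact_completely_regular.
have [V xV VW] := reg x W xW.
exists (C0 `&` closure V); split.
- by apply: compact_closedI => //; exact: closed_closure.
- by apply: closedI => //; exact: closed_closure.
- by apply: filterI => //; apply: filterS xV; exact: subset_closure.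
- by move=> y [_ /VW].
Qed.

End LocallyCompact.

Section ChabautyFellSpace.
Context {Z : topologicalType}.
Implicit Types (C O : set Z) (Y : closed_subset Z).

Lemma chabauty_openE (W : set (closed_subset Z)) : open W = chabauty_open W.
Proof. by []. Qed.

Lemma open_miss C : compact C -> open [set Y : closed_subset Z | C `&` Y = set0].
Proof.
move=> cC; rewrite chabauty_openE => Y CY; exists C, set0; split=> //.
by move=> X [].
Qed.

Lemma open_hit O : open O -> open [set Y : closed_subset Z | O `&` Y !=set0].
Proof.
move=> oO; rewrite chabauty_openE => Y CY; exists set0, [set O]; split=> //.
- exact: compact0.
- by move=> _ ->.
- by split; [rewrite set0I|move=> _ ->].
- by move=> X [_]; apply.
Qed.

(** An ultrafilter F converges to the set L of the points all of whose
    neighbourhoods are hit F-often.  Each point outside L has a neighbourhood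
    that is missed F-often, and finitely many of these cover a compact set
    disjoint from L. *)
Lemma closed_subset_compact : compact [set: closed_subset Z].
Proof.
rewrite compact_ultra => F FU _.
have Fp : ProperFilter F by exact: ultra_proper.
pose L := [set x : Z | forall O, open O -> O x ->
  F [set Y : closed_subset Z | O `&` Y !=set0]].
have cL : closed L.
  move=> x clx O oO Ox.
  by have [y [Ly Oy]] := clx O (open_nbhs_nbhs (conj oO Ox)); exact: Ly.
exists (ClosedSubset cL); split=> // W.
rewrite nbhsE => -[B [oB BL] BW]; apply: filterS BW _.
have [C [Os [cC /finite_seqP[D OsD] oOs [CL OsL] CB]]] := oB _ BL.
apply: filterS CB _; apply: filterI.
  have : F [set Y : closed_subset Z | C `<=` ~` (Y : set Z)].
    have near_cov := (compact_near_coveringP C).1 cC _ F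
      (fun Y x => ~ closed_subset_set Y x) _.
    apply: near_cov => x Cx.
    have [V [oV Vx nFV]] : exists O, [/\ open O, O x &
        ~ F [set Y : closed_subset Z | O `&` Y !=set0]].
      apply: contrapT => h; suff : (set0 : set Z) x by [].
      rewrite -CL; split=> // O oO Ox; apply: contrapT => nF.
      by apply: h; exists O.
    have [//|FnV] := in_ultra_setVsetC
      [set Y : closed_subset Z | V `&` Y !=set0] FU.
    exists (V, ~` [set Y : closed_subset Z | V `&` Y !=set0]).
      by split => //; exact: open_nbhs_nbhs.
    by move=> [y Y] [/= Vy nVY] Yy; apply: nVY; exists y.
  by apply: filterS => Y CY; rewrite -subset0 => x [/CY].
have : forall A, A \in D -> F [set Y : closed_subset Z | A `&` Y !=set0].
  move=> A DA; have OsA : Os A by rewrite OsD.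
  have [x [Ax Lx]] := OsL _ OsA.
  by apply: Lx => //; exact: oOs.
rewrite OsD; elim: D {OsD} => [|A D IH] hD; first by apply: filterE => Y O.
have FA := hD A (mem_head _ _).
have FD : F [set Y : closed_subset Z |
    forall O, [set` D] O -> O `&` Y !=set0].
  by apply: IH => A' DA'; apply: hD; rewrite inE DA' orbT.
apply: filterS (filterI FA FD) => Y [AY DY] O /=.
by rewrite inE => /predU1P[->|/DY].
Qed.

Lemma closed_subset_eq Y Y' : Y = Y' :> set Z -> Y = Y'.
Proof.
case: Y Y' => [A cA] [B cB] /= AB; move: cA; rewrite AB => cA.
by congr ClosedSubset; exact: Prop_irrelevance.
Qed.

(** If x lies in Y but not in Y', a compact neighbourhood C of x disjoint from
    Y' separates them: Y hits the interior of C and Y' misses C. *)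
Lemma closed_subset_hausdorff (R : realType) : locally_compact [set: Z] ->
  hausdorff_space Z -> hausdorff_space (closed_subset Z).
Proof.
move=> hlc hT2.
have sep Y Y' (x : Z) : (Y : set Z) x -> ~ (Y' : set Z) x ->
    exists A B : set (closed_subset Z),
      [/\ open A, open B, A Y, B Y' & A `&` B = set0].
  move=> Yx nYx'.
  have [|C [cC clC xC CY']] :=
      locally_compact_nbhs hlc hT2 R (x := x) (W := ~` (Y' : set Z)).
    apply: open_nbhs_nbhs; split=> //; apply: closed_openC.
    exact: closed_subsetP.
  exists [set Y | C^° `&` Y !=set0], [set Y | C `&` Y = set0]; split.
  - by apply: open_hit; exact: open_interior.
  - exact: open_miss.
  - by exists x; split=> //; exact: xC.
  - by rewrite /= -subset0 => y [/CY'].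
  - rewrite -subset0 => D [[y [/interior_subset Cy Dy]] /= CD].
    by suff : (set0 : set Z) y by []; rewrite -CD.
rewrite open_hausdorff => Y Y' /eqP YY'.
have : exists x, ((Y : set Z) x /\ ~ (Y' : set Z) x) \/
    ((Y' : set Z) x /\ ~ (Y : set Z) x).
  apply: contrapT => h; apply: YY'; apply: closed_subset_eq.
  apply/seteqP; split=> x Yx; apply: contrapT => nYx; apply: h; exists x.
    by left.
  by right.
move=> [x [[Yx nYx]|[Yx nYx]]].
  have [A [B [oA oB AY BY AB]]] := sep _ _ _ Yx nYx.
  by exists (A, B); split=> //; [exact: mem_set|exact: mem_set|exact/eqP].
have [A [B [oA oB AY BY AB]]] := sep _ _ _ Yx nYx.
exists (B, A); split=> //; [exact: mem_set|exact: mem_set|].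
by rewrite setIC; exact/eqP.
Qed.

End ChabautyFellSpace.

Section SubtypeTopology.
Context {T : topologicalType} (A : set T).

Lemma open_set_valP (W : set A) : open W ->
  exists2 V : set T, open V & W = set_val @^-1` V.
Proof. by move=> [V oV <-]; exists V. Qed.

Lemma set_val_compact (C : set T) : compact (A `&` C) ->
  compact (set_val @^-1` C : set A).
Proof.
move=> cAC F Fp FC.
have FAC : (set_val @ F) (A `&` C).
  by apply: (@filterS _ F _ _ _ _ FC) => x Cx; split=> //; exact: set_valP.
have [p [[Ap Cp] clp]] := cAC _ _ FAC.
exists (exist _ p (mem_set Ap)); split=> //.
move=> V W FV; rewrite nbhsE => -[B [/open_set_valP[B' oB' ->] B'p] BW].
have /clp/(_ (open_nbhs_nbhs (conj oB' B'p))) : (set_val @ F) (set_val @` V).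
  by apply: (@filterS _ F _ _ _ _ FV) => x Vx; exists x.
by move=> [_ [[x Vx <-] B'x]]; exists x; split=> //; exact: BW.
Qed.

End SubtypeTopology.

Section TopologicalGroup.
Context {G : topologicalGroupType}.
Implicit Types (D : closed_subset G) (U K : set G).

Lemma mulg_left_continuous (g : G) : continuous (fun x : G => (g * x)%g).
Proof.
move=> x; apply: (@continuous_comp _ (G * G)%type _
  (fun x => (g, x)) (fun p => (p.1 * p.2)%g)).
  by apply: cvg_pair => //; exact: cvg_cst.
exact: mulg_continuous.
Qed.

Lemma mulg_imageE (g : G) (A : set G) :
  [set (g * x)%g | x in A] = (fun x => (g^-1 * x)%g) @^-1` A.
Proof.
apply/seteqP; split=> [_ [x Dx <-]|x Dx] /=; first by rewrite mulKg.
by exists (g^-1 * x)%g => //; rewrite mulVKg.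
Qed.

Lemma open_mulg (g : G) U : open U -> open [set (g * u)%g | u in U].
Proof.
move=> oU; rewrite mulg_imageE; apply: open_comp => // x _.
exact: mulg_left_continuous.
Qed.

Lemma translate_continuous (g : G) : continuous (@translate G g).
Proof.
apply/continuousP => W oW; rewrite chabauty_openE => D.
move=> /oW[C [Os [cC fOs oOs [CD OsD] CW]]].
exists [set (g^-1 * x)%g | x in C],
  [set (fun x => (g * x)%g) @^-1` O | O in Os]; split.
- apply: continuous_compact => //; apply: continuous_subspaceT.
  exact: mulg_left_continuous.
- exact: finite_image.
- move=> _ [V OsV <-]; apply: open_comp => [x _|]; last exact: oOs.
  exact: mulg_left_continuous.
- split.
    rewrite -subset0 => _ [[x Cx <-] Dx].
    suff : (set0 : set G) x by [].
    by rewrite -CD; split=> //; exists (g^-1 * x)%g => //; rewrite mulVKg.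
  move=> _ [V /OsD[y [Vy [x Dx gxy]]] <-]; exists x; split=> //=.
  by rewrite gxy.
- move=> E [CE OsE]; apply: CW; split.
    rewrite -subset0 => y [Cy [x Ex gxy]].
    suff : (set0 : set G) x by [].
    by rewrite -CE; split=> //; exists y => //; rewrite -gxy mulKg.
  move=> O OsO; have [|x [/= Ogx Ex]] := OsE ((fun x => (g * x)%g) @^-1` O).
    by exists O.
  by exists (g * x)%g; split=> //; exists x.
Qed.

Lemma translateK (g : G) : cancel (@translate G g) (@translate G g^-1%g).
Proof.
move=> D; apply: closed_subset_eq => /=; apply/seteqP; split=> x.
  by move=> [_ [y Dy <-] <-]; rewrite mulKg.
by move=> Dx; exists (g * x)%g; [exists x|rewrite mulKg].
Qed.

Lemma translateVK (g : G) : cancel (@translate G g^-1%g) (@translate G g).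
Proof. by move=> D; have := @translateK g^-1%g D; rewrite invgK. Qed.

(** Two distinct points of D in gU persist nearby, inside disjoint open subsets
    of gU; and g lies in DK exactly when D meets the compact set [g K^-1].
    Non-emptiness is a consequence of [D K = G]. *)
Lemma Del_closed U K : hausdorff_space G -> open U -> compact K ->
  closed (Del U K).
Proof.
move=> hT2 oU cK; rewrite -[Del U K]setCK; apply: open_closedC.
rewrite openE => D nDel.
have [nA|] := pselect (exists g x y : G, [/\ x <> y,
    ([set (g * u)%g | u in U] `&` D) x & ([set (g * u)%g | u in U] `&` D) y]).
  have [g [x [y [/eqP xy [Ux Dx] [Uy Dy]]]]] := nA.
  move: (hT2); rewrite open_hausdorff => /(_ x y xy) [[A B]].
  move=> /= -[/set_mem Ax /set_mem By] [oA oB /eqP AB].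
  have ogU := open_mulg g oU.
  have h1 : nbhs D [set E : closed_subset G |
      ([set (g * u)%g | u in U] `&` A) `&` E !=set0].
    apply: open_nbhs_nbhs; split; first by apply: open_hit; exact: openI.
    by exists x.
  have h2 : nbhs D [set E : closed_subset G |
      ([set (g * u)%g | u in U] `&` B) `&` E !=set0].
    apply: open_nbhs_nbhs; split; first by apply: open_hit; exact: openI.
    by exists y.
  apply: filterS (filterI h1 h2) => E /= [[x' [[Ux' Ax'] Ex']] [y' [[Uy' By'] Ey']]].
  move=> [_ /(_ g x' y') + _] => /(_ (conj Ux' Ex') (conj Uy' Ey')) xy'.
  suff : (set0 : set G) x' by [].
  by rewrite -AB; split=> //; rewrite xy'.
move=> nA.
have U1 g : is_subset1 ([set (g * u)%g | u in U] `&` D).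
  move=> x y Ux Uy; apply: contrapT => xy; apply: nA.
  by exists g, x, y.
have nB : ~ [set (d * k)%g | d in D & k in K] = setT.
  move=> DK; apply: nDel; split=> //.
  have : [set (d * k)%g | d in D & k in K] 1%g by rewrite DK.
  by move=> [d Dd _]; exists d.
have [g nDg] : exists g, ~ [set (d * k)%g | d in D & k in K] g.
  apply: contrapT => h; apply: nB; apply/seteqP; split=> // g _.
  by apply: contrapT => ?; apply: h; exists g.
have cgK : compact [set (g * k^-1)%g | k in K].
  apply: (continuous_compact _ cK); apply: continuous_subspaceT => k.
  apply: (@continuous_comp _ _ _ (fun k : G => k^-1)%g (fun x => (g * x)%g)).
    exact: invg_continuous.
  exact: mulg_left_continuous.
have : nbhs D [set E : closed_subset G |
    [set (g * k^-1)%g | k in K] `&` E = set0].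
  apply: open_nbhs_nbhs; split; first exact: open_miss.
  rewrite /= -subset0 => _ [[k Kk <-] Dgk]; apply: nDg.
  by exists (g * k^-1)%g => //; exists k => //; rewrite mulgVK.
apply: filterS => E /= gKE [_ _ DK].
have : [set (d * k)%g | d in E & k in K] g by rewrite DK.
move=> [d Ed [k Kk dk]]; suff : (set0 : set G) d by [].
by rewrite -gKE; split=> //; exists k => //; rewrite -dk mulgK.
Qed.

Section Systems.
Context {U K : set G}.
Context (cDel : closed (Del U K)).

Lemma carrier_Del (Omega : IG U K) : carrier Omega `<=` Del U K.
Proof. by move=> _ [D _ <-]; exact: set_valP. Qed.

Lemma carrier_closed (Omega : IG U K) : closed (carrier Omega).
Proof.
have := @closed_subsetP _ (set_val Omega) => /closed_openC /open_set_valP[V oV WV].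
suff -> : carrier Omega = Del U K `&` ~` V.
  by apply: closedI => //; exact: open_closedC.
apply/seteqP; split=> [_ [D WD <-]|D [DelD nVD]].
  split; first exact: set_valP.
  move=> VD; suff : (~` (set_val Omega : set (Del U K))) D by [].
  by rewrite WV.
pose D' : Del U K := exist _ D (mem_set DelD).
exists D' => //; apply: contrapT => nW.
have : (~` (set_val Omega : set (Del U K))) D' by [].
by rewrite WV.
Qed.

(** C is compact, being closed in a compact space, so the systems that miss it
    form a neighbourhood of Omega. *)
Lemma IG_cvg_miss (Omega_ : nat -> IG U K) (Omega : IG U K)
    (C : set (closed_subset G)) : Omega_ @ \oo --> Omega ->
  closed C -> C `&` carrier Omega = set0 ->
  \forall l \near \oo, C `&` carrier (Omega_ l) = set0.
Proof.
move=> cvg cC CO.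
have cptC : compact (set_val @^-1` C : set (Del U K)).
  apply: set_val_compact; apply: (subclosed_compact _ closed_subset_compact) => //.
  exact: closedI.
have CE (W : IG U K) : C `&` carrier W = set0 <->
    (set_val @^-1` C : set (Del U K)) `&` (set_val W : set (Del U K)) = set0.
  split=> h; rewrite -subset0.
    move=> D [CD WD]; suff : (set0 : set (closed_subset G)) (set_val D) by [].
    by rewrite -h; split=> //; exists D.
  move=> E [CE [D WD DE]]; suff : (set0 : set (Del U K)) D by [].
  by rewrite -h; split=> //=; rewrite DE.
have : (set_val @ nbhs Omega) --> set_val Omega by exact: initial_continuous.
move=> /(_ _ (open_nbhs_nbhs (conj (open_miss cptC) _))).
move=> /(_ ((CE Omega).1 CO)) /cvg /= near_miss.
by apply: (@filterS _ \oo _ _ _ _ near_miss) => l /= /(CE (Omega_ l)).2.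
Qed.

End Systems.
End TopologicalGroup.

(** * Convergence of the invariant measures *)

Section DeloneSystems.
Context {R : realType} {G : topologicalGroupType}.
Context (hlc : locally_compact [set: G]) (hT2 : hausdorff_space G).
Context {U K : set G} (oU : open U) (cK : compact K).

Let X := closed_subset G.
Let cDel : closed (Del U K). Proof. exact: Del_closed. Qed.

Lemma ultralimit_carrier (UF : set_system nat) (Omega_ : nat -> IG U K)
    (Omega : IG U K) (mu_ : nat -> probability (borel X) R) (F : set X) :
  UltraFilter UF -> \oo `<=` UF -> Omega_ @ \oo --> Omega ->
  (forall l, invariant_probability (Omega_ l) (mu_ l)) ->
  closed F -> F `&` carrier Omega = set0 -> ultralimit UF mu_ F = 0.
Proof.
move=> hUF ooUF cvg inv cF FO.
have UFp : ProperFilter UF by exact: ultra_proper.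
apply: (@cvg_lim _ (@Rhausdorff R) _ UF) => //.
apply: cvg_near_cst; apply: ooUF.
apply: (@filterS _ \oo _ _ _ _ (IG_cvg_miss cDel cvg cF FO)) => l FOl.
have mF : measurable (F : set (borel X)) := closed_borel cF.
have mO : measurable (carrier (Omega_ l) : set (borel X)).
  by apply: closed_borel; exact: carrier_closed.
have mu0 : mu_ l (~` carrier (Omega_ l)) = 0%E.
  by rewrite probability_setC// (inv l).1 subee.
suff -> : mu_ l F = 0%E by [].
apply/eqP; rewrite eq_le measure_ge0 andbT -mu0.
apply: le_measure; rewrite ?inE//; first exact: measurableC.
by apply/disjoints_subset.
Qed.

(** Any ultralimit of the mu_ is an invariant probability carried by Omega, so
    unique ergodicity identifies it with mu. *)
Lemma Delone_liminf_open (Omega : IG U K) (mu : probability (borel X) R)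
    (Omega_ : nat -> IG U K) (mu_ : nat -> probability (borel X) R)
    (hue : uniquely_ergodic R Omega) (hmu : invariant_probability Omega mu)
    (hmu_ : forall l, invariant_probability (Omega_ l) (mu_ l))
    (hcvg : Omega_ @ \oo --> Omega) (O : set X) (e : R) : open O -> 0 < e ->
  \forall n \near \oo, fine (mu O) <= fine (mu_ n O) + e.
Proof.
apply: liminf_open_of_unique_limit.
- exact: closed_subset_hausdorff R hlc hT2.
- exact: closed_subset_compact.
move=> UF hUF ooUF nu nu_outer nu_inner A mA.
have [mu0 [_ mu0_uniq]] := hue.
suff inv_nu : invariant_probability Omega nu.
  by rewrite (mu0_uniq nu)// (mu0_uniq mu).
split.
  have mO : measurable (carrier Omega : set (borel X)).
    by apply: closed_borel; exact: carrier_closed.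
  have nuC : nu (~` carrier Omega) = 0%E.
    have oC : open (~` carrier Omega).
      by apply: closed_openC; exact: carrier_closed.
    apply/eqP; rewrite eq_le measure_ge0 andbT nu_inner//.
    apply: ge_ereal_sup => _ [F [cF FO] <-].
    rewrite (ultralimit_carrier hUF ooUF hcvg hmu_ cF)//.
    exact/disjoints_subset.
  have := probability_setC nu (measurableC mO).
  by rewrite setCK nuC sube0.
move=> g B mB; rewrite !nu_outer.
apply: (outer_ultralimit_invariant _ (t := @translate G g^-1%g)).
- exact: translate_continuous.
- exact: translate_continuous.
- exact: translateK.
- exact: translateVK.
- by move=> n C mC; exact: (hmu_ n).2.
Qed.

Lemma Rintegral_carrier (Omega : IG U K) (mu : probability (borel X) R)
    (g : X -> R) : invariant_probability Omega mu ->
  {within Del U K, continuous g} ->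
  (\int[mu]_(x in carrier Omega) g x = \int[mu]_(x in Del U K) g x)%R.
Proof.
move=> inv cg.
have mD : measurable (Del U K : set (borel X)) by exact: closed_borel.
have mO : measurable (carrier Omega : set (borel X)).
  by apply: closed_borel; exact: carrier_closed.
have cptD : compact (Del U K).
  by apply: (subclosed_compact _ closed_subset_compact).
have [M M0 gM] := within_continuous_bounded cg cptD.
have ig : mu.-integrable (Del U K) (EFin \o g).
  apply: (bounded_integrable (M := M)) => //.
    by rewrite (le_lt_trans (probability_le1 mu mD))// ltry.
  exact: within_continuous_measurable.
rewrite /Rintegral [in RHS](negligible_integral 
  (N := Del U K `\` carrier Omega : set (borel X)))//.
- congr (fine (integral _ _ _)); apply/seteqP; split=> D.
    move=> OD; split; first exact: carrier_Del OD.
    by move=> [].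
  by move=> [DelD nD]; apply: contrapT => nOD; exact: nD.
- exact: measurableD.
have mu0 : mu (~` carrier Omega) = 0%E.
  by rewrite probability_setC// inv.1 subee.
apply/eqP; rewrite eq_le measure_ge0 andbT -mu0.
apply: le_measure; rewrite ?inE//; first exact: measurableD.
exact: measurableC.
Qed.

Lemma Delone_cvg_Rintegral (Omega : IG U K) (mu : probability (borel X) R)
    (Omega_ : nat -> IG U K) (mu_ : nat -> probability (borel X) R)
    (hue : uniquely_ergodic R Omega) (hmu : invariant_probability Omega mu)
    (hmu_ : forall l, invariant_probability (Omega_ l) (mu_ l))
    (hcvg : Omega_ @ \oo --> Omega) (g : X -> R) :
  {within Del U K, continuous g} ->
  (\int[mu_ n]_(x in carrier (Omega_ n)) g x)%R @[n --> \oo] -->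
  (\int[mu]_(x in carrier Omega) g x)%R.
Proof.
move=> cg; rewrite Rintegral_carrier//.
under eq_fun do rewrite Rintegral_carrier//.
have mD : measurable (Del U K : set (borel X)) by exact: closed_borel.
have nu1 (W : IG U K) (nu : probability (borel X) R) :
    invariant_probability W nu -> nu (Del U K) = 1%E.
  move=> [nuW _]; apply/eqP; rewrite eq_le probability_le1//= -nuW.
  apply: le_measure; rewrite ?inE//; last exact: carrier_Del.
  by apply: closed_borel; exact: carrier_closed.
apply: cvg_Rintegral_within => //.
- exact: Delone_liminf_open hue hmu hmu_ hcvg.
- by apply: (subclosed_compact _ closed_subset_compact).
- exact: nu1 hmu.
- by move=> n; exact: nu1 (hmu_ n).
Qed.

End DeloneSystems.

(** * Test functions and the continuity of periodizations *)

Section TestFunctions.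
Context {R : realType} {T : topologicalType}.
Implicit Types u v : T -> R.

Definition supported_in (C : set T) u := forall x, ~ C x -> u x = 0.

Definition test_function u :=
  continuous u /\ exists2 C, compact C & supported_in C u.

Lemma supported_inU C1 C2 u v : supported_in C1 u -> supported_in C2 v ->
  supported_in (C1 `|` C2) (fun x => u x + v x).
Proof. by move=> uC vC x; rewrite not_orE => -[/uC -> /vC ->]; rewrite addr0. Qed.

Lemma test_functionD u v : test_function u -> test_function v ->
  test_function (fun x => u x + v x).
Proof.
move=> [cu [C1 cC1 uC1]] [cv [C2 cC2 vC2]]; split.
  by move=> x; apply: cvgD; [exact: cu|exact: cv].
by exists (C1 `|` C2); [exact: compactU|exact: supported_inU].
Qed.

Lemma test_functionZ (k : R) u : test_function u ->
  test_function (fun x => k * u x).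
Proof.
move=> [cu [C cC uC]]; split.
  by move=> x; apply: cvgM; [exact: cvg_cst|exact: cu].
by exists C => // x /uC ->; rewrite mulr0.
Qed.

Context (hlc : locally_compact [set: T]) (hT2 : hausdorff_space T).

Lemma bump_function (x : T) (W : set T) : nbhs x W ->
  exists phi : T -> R, [/\ continuous phi, forall y, 0 <= phi y <= 1,
    exists2 N, open N /\ N x & forall y, N y -> phi y = 1 &
    exists2 C, compact C & C `<=` W /\ supported_in C phi].
Proof.
move=> xW; have [C [cC clC xC CW]] := locally_compact_nbhs hlc hT2 R xW.
have cr : completely_regular_space T.
  exact: (locally_compact_completely_regular (R := R)).
have cB : closed (~` C^°) by apply: open_closedC; exact: open_interior.
have nBx : ~ (~` C^°) x by move=> /(_ xC).
have [f [cf f01 fx fB]] := (@uniform_separatorP T R _ _).1 (cr x _ cB nBx).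
have fx0 : f x = 0 by apply: fx; exists x.
(* f vanishes at x and is 1 off C; the cut-off makes the bump constant where
   f < 1/3, a neighbourhood of x, and zero where f > 2/3. *)
exists (fun y => Num.min 1 (Num.max 0 (2 - 3 * f y))); split.
- move=> y; apply: (@continuous_min R T (fun=> 1)
    (fun y => Num.max 0 (2 - 3 * f y))); first exact: cvg_cst.
  apply: (@continuous_max R T (fun=> 0) (fun y => 2 - 3 * f y)).
    exact: cvg_cst.
  apply: cvgB; first exact: cvg_cst.
  by apply: cvgM; [exact: cvg_cst|exact: cf].
- by move=> y; rewrite le_min ler01 le_max lexx ge_min lexx.
- exists (f @^-1` [set r | r < 3^-1]).
    split; last by rewrite /= fx0.
    by apply: open_comp => [y _|]; [exact: cf|exact: open_lt].
  move=> y /= fy; rewrite min_l// le_max; apply/orP; right.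
  by lra.
- exists C => //; split=> // y nCy.
  have -> : f y = 1.
    by apply: fB; exists y => // /interior_subset.
  by rewrite max_l ?min_r//; lra.
Qed.

(** Finitely many bumps cover C and their sum is at least 1 there.  The finite
    choice is hidden in the filter F of sets of functions that contain all
    functions above some nonnegative test function; sums make it a filter. *)
Lemma test_function_ge1 (C : set T) : compact C ->
  exists v, [/\ test_function v, forall x, 0 <= v x & forall x, C x -> 1 <= v x].
Proof.
move=> cC.
pose F := filter_from [set v : T -> R | test_function v /\ forall x, 0 <= v x]
  (fun v => [set w | forall x, v x <= w x]).
have FF : Filter F.
  apply: filter_from_filter.
    exists (fun=> 0); split=> //; split; first by move=> x; exact: cvg_cst.
    by exists set0 => //; exact: compact0.
  move=> v w [tv v0] [tw w0]; exists (fun x => v x + w x).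
    by split=> [|x]; [exact: test_functionD|rewrite addr_ge0].
  by move=> z vwz; split=> x; apply: le_trans (vwz x);
    rewrite ?lerDl ?lerDr.
have [|v [tv v0] vC] := (compact_near_coveringP C).1 cC _ F
  (fun v x => 1 <= v x) FF.
  move=> x Cx; have [phi [cphi phi01 [N [oN Nx] phiN] [B cB [_ phiB]]]] :=
    bump_function (filterT : nbhs x setT).
  exists (N, [set w | forall x, phi x <= w x]) => /=.
    split; first exact: open_nbhs_nbhs.
    exists phi => //; split; first by split=> //; exists B.
    by move=> y; case/andP: (phi01 y).
  by move=> [y w] /= [/phiN <- ]; apply.
by exists v; split=> //; exact: vC.
Qed.

End TestFunctions.

Section Periodization.
Context {R : realType} {G : topologicalGroupType}.
Context (hlc : locally_compact [set: G]) (hT2 : hausdorff_space G).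
Context {U K : set G} (oU : open U) (U1 : U 1%g).
Implicit Types (D : closed_subset G) (u v : G -> R) (C : set G).

Definition Rperiodization u D : R := \sum_(x \in (D : set G)) u x.

Let mulU (x : G) : [set (x * z)%g | z in U] x.
Proof. by exists 1%g => //; rewrite mulg1. Qed.

(** Finitely many translates of U cover C, and each contains at most one point
    of D. *)
Lemma Del_finite D C : Del U K D -> compact C -> finite_set (D `&` C).
Proof.
move=> [_ D1 _]; rewrite compact_cover => cC.
have [|x Cx|s sC Cs] := cC _ C (fun x => [set (x * z)%g | z in U]).
- by move=> x Cx; exact: open_mulg.
- by exists x.
have := finite_fset s; move: Cs; set A := (X in cover X _) => CA finA.
have DCA : (D : set G) `&` C `<=`
    \bigcup_(x in A) ([set (x * z)%g | z in U] `&` (D : set G)).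
  by move=> x [Dx /CA[y sy Uyx]]; exists y.
apply: (sub_finite_set DCA); apply: bigcup_finite; first exact: finA.
move=> x _; have [->|/set0P[y Uy]] := eqVneq ([set (x * z)%g | z in U] `&` D) set0.
  exact: finite_set0.
apply: (sub_finite_set (B := [set y])); last exact: finite_set1.
by move=> z Uz; exact: (D1 x).
Qed.

Lemma Rperiodization_restrict u C D : supported_in C u ->
  Rperiodization u D = \sum_(x \in (D : set G) `&` C) u x.
Proof.
move=> uC; apply/esym/fsbig_widen; first exact: subIsetl.
by move=> x [Dx]; rewrite /= not_andE => -[//|/uC].
Qed.

Lemma Rperiodization0 u C D : supported_in C u -> C `&` D = set0 ->
  Rperiodization u D = 0.
Proof.
by move=> uC CD; rewrite (Rperiodization_restrict _ uC) setIC CD fsbig_set0.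
Qed.

Lemma Rperiodization1 u C D x : supported_in C u -> is_subset1 (C `&` D) ->
  (C `&` D) x -> Rperiodization u D = u x.
Proof.
move=> uC CD1 CDx; rewrite (Rperiodization_restrict _ uC) setIC.
have -> : C `&` D = [set x].
  by apply/seteqP; split=> [y CDy|_ ->//]; exact: CD1.
by rewrite fsbig_set1.
Qed.

Lemma RperiodizationD u v D : Del U K D -> test_function u -> test_function v ->
  Rperiodization (fun x => u x + v x) D = Rperiodization u D + Rperiodization v D.
Proof.
move=> DelD [_ [C1 cC1 uC1]] [_ [C2 cC2 vC2]].
have uC : supported_in (C1 `|` C2) u by move=> x; rewrite not_orE => -[/uC1].
have vC : supported_in (C1 `|` C2) v by move=> x; rewrite not_orE => -[_ /vC2].
rewrite (Rperiodization_restrict _ uC) (Rperiodization_restrict _ vC).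
rewrite (Rperiodization_restrict _ (supported_inU uC1 vC2)).
by rewrite -fsbig_split//; exact: Del_finite (compactU cC1 cC2).
Qed.

(** When u is supported in xU with x in D0, the sum has a single term: nearby
    sets D have a point y of xU with u y close to u x, and no other point in
    xU. *)
Lemma Rperiodization_near_local u C (x : G) D0 (e : R) : continuous u ->
  C `<=` [set (x * z)%g | z in U] -> supported_in C u ->
  Del U K D0 -> (D0 : set G) x -> 0 < e ->
  \forall D \near D0, Del U K D ->
    `|Rperiodization u D0 - Rperiodization u D| < e.
Proof.
move=> cu CU uC Del0 D0x e0.
have uU : supported_in [set (x * z)%g | z in U] u.
  by move=> y nUy; apply: uC => /CU.
pose V := [set (x * z)%g | z in U] `&` u @^-1` (ball (u x) e).
have oV : open V.
  apply: openI; first exact: open_mulg.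
  by apply: open_comp => [y _|]; [exact: cu|exact: ball_open].
have : nbhs D0 [set D : closed_subset G | V `&` D !=set0].
  apply: open_nbhs_nbhs; split; first exact: open_hit.
  by exists x; split=> //; split=> //; exact: ballxx.
apply: filterS => D /= [y [[Uy uxy] Dy]] [_ D1 _].
rewrite (Rperiodization1 (x := x) uU)//; last first.
  by case: Del0.
by rewrite (Rperiodization1 (x := y) uU).
Qed.

(** Induction on the finite set [D0 `&` C]: a bump phi at one of its points x
    splits u into u phi, which is local, and u (1 - phi), whose support
    misses x. *)
Lemma Rperiodization_near u C D0 (s : seq G) (e : R) : continuous u ->
  compact C -> supported_in C u -> Del U K D0 ->
  (D0 : set G) `&` C `<=` [set` s] -> 0 < e ->
  \forall D \near D0, Del U K D ->
    `|Rperiodization u D0 - Rperiodization u D| < e.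
Proof.
move=> + + + Del0; elim: s u C e => [|x s IH] u C e cu cC uC sC e0.
  have CD0 : C `&` D0 = set0.
    by rewrite -subset0 => x [Cx Dx]; have := sC _ (conj Dx Cx).
  have : nbhs D0 [set D : closed_subset G | C `&` D = set0].
    by apply: open_nbhs_nbhs; split=> //; exact: open_miss.
  apply: filterS => D /= CD _.
  by rewrite !(Rperiodization0 uC)// subrr normr0.
have [[D0x Cx]|nx] := pselect (((D0 : set G) `&` C) x); last first.
  apply: (IH u C) => // y DCy; have /= := sC _ DCy.
  by rewrite inE => /predU1P[yx|//]; move: nx; rewrite -yx.
have [phi [cphi phi01 [N [oN Nx] phiN] [B cB [BU phiB]]]] :=
  bump_function (R := R) hlc hT2 (open_nbhs_nbhs (conj (open_mulg x oU) (mulU x))).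
pose u1 y := u y * phi y.
pose u2 y := u y * (1 - phi y).
have cu1 : continuous u1.
  by move=> y; apply: cvgM; [exact: cu|exact: cphi].
have cu2 : continuous u2.
  move=> y; apply: cvgM; first exact: cu.
  by apply: cvgB; [exact: cvg_cst|exact: cphi].
have u1B : supported_in B u1 by move=> y /phiB; rewrite /u1 => ->; rewrite mulr0.
have u2C : supported_in (C `\` N) u2.
  move=> y; rewrite /u2 /= not_andE => -[/uC->|]; first by rewrite mul0r.
  by move=> /contrapT /phiN ->; rewrite subrr mulr0.
have cCN : compact (C `\` N).
  by apply: compact_closedI => //; exact: open_closedC.
have e2 : 0 < e / 2 by rewrite divr_gt0.
have near1 := Rperiodization_near_local cu1 BU u1B Del0 D0x e2.
have near2 : \forall D \near D0, Del U K D ->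
    `|Rperiodization u2 D0 - Rperiodization u2 D| < e / 2.
  apply: (IH u2 (C `\` N)) => // y [Dy [Cy nNy]].
  have /= := sC _ (conj Dy Cy); rewrite inE => /predU1P[yx|//].
  by move: nNy; rewrite yx.
apply: filterS (filterI near1 near2) => D [h1 h2] DelD.
have t1 : test_function u1 by split=> //; exists B.
have t2 : test_function u2 by split=> //; exists (C `\` N).
have uE D' : Del U K D' ->
    Rperiodization u D' = Rperiodization u1 D' + Rperiodization u2 D'.
  move=> Del'; rewrite -RperiodizationD//; congr (Rperiodization _ _).
  by apply/funext => y; rewrite /u1 /u2; ring.
rewrite !uE// opprD addrACA (splitr e) (le_lt_trans (ler_normD _ _))//.
by rewrite ltrD// ?h1 ?h2.
Qed.

Lemma Rperiodization_continuous u : test_function u ->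
  {within Del U K, continuous (Rperiodization u)}.
Proof.
move=> [cu [C cC uC]]; apply/subspace_continuousP => D0 Del0.
apply/cvgrPdist_lt => e e0.
have /finite_seqP[s sE] := Del_finite Del0 cC.
rewrite /within/=; apply: (Rperiodization_near cu cC uC Del0 (s := s)) => //.
by rewrite sE.
Qed.

End Periodization.

(** * Approximate identities for Haar measure *)

(** Applied to [v (h^-1 * g)], this gives the uniform continuity of v when h is
    the parameter, and the continuity of convolutions when g is. *)
Lemma near_compact_uniform {R : realType} {S T : topologicalType}
    (F : S * T -> R) (K : set T) (s0 : S) (e : R) :
  continuous F -> compact K -> 0 < e ->
  \forall s \near s0, forall k, K k -> `|F (s0, k) - F (s, k)| < e.
Proof.
move=> cF cK e0.
have e20 : 0 < e / 2 by rewrite divr_gt0.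
apply: ((compact_near_coveringP K).1 cK _ (nbhs s0)
  (fun s k => `|F (s0, k) - F (s, k)| < e)) => k Kk.
have /cvgrPdist_lt/(_ _ e20) [[A B] /= [s0A kB] AB] := cF (s0, k).
exists (B, A) => // -[k' s] /= [Bk' As].
have h1 := AB (s, k') (conj As Bk').
have h2 := AB (s0, k') (conj (nbhs_singleton s0A) Bk').
have -> : F (s0, k') - F (s, k') =
  (F (s0, k) - F (s, k')) - (F (s0, k) - F (s0, k')) by ring.
by rewrite (splitr e) (le_lt_trans (ler_normB _ _))// ltrD.
Qed.

Section RadonIntegral.
Context {R : realType} {T : ptopologicalType}.
Context (hT2 : hausdorff_space T).
Context {m : {measure set (borel T) -> \bar R}} (hm : radon m).
Implicit Types u v : T -> R.

Lemma compact_borel (C : set T) : compact C -> measurable (C : set (borel T)).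
Proof. by move=> cC; apply: closed_borel; exact: compact_closed. Qed.

Lemma test_function_bounded u : test_function u ->
  exists2 M, 0 < M & forall x, `|u x| <= M.
Proof.
move=> [cu [C cC uC]].
have [M M0 uM] := within_continuous_bounded (continuous_subspaceT cu) cC.
exists M => // x; have [/uM//|/uC ->] := pselect (C x).
by rewrite normr0 ltW.
Qed.

Lemma test_function_integrable u : test_function u ->
  m.-integrable setT (EFin \o u).
Proof.
move=> tu; have [M M0 uM] := test_function_bounded tu.
have [cu [C cC uC]] := tu; have mC := compact_borel cC.
have : m.-integrable (C : set (borel T)) (EFin \o u).
  apply: (bounded_integrable (M := M)) => //; first by case: hm => + _ _; exact.
  apply: within_continuous_measurable; last exact: compact_closed.
  exact: continuous_subspaceT.
move=> /(integrable_mkcond _ mC).1; congr (integrable _ _ _).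
apply/funext => x; rewrite /patch/=; case: ifPn => //; rewrite notin_setE.
by move=> /uC ->.
Qed.

End RadonIntegral.

Section Haar.
Context {R : realType} {G : topologicalGroupType}.
Context (hlc : locally_compact [set: G]) (hT2 : hausdorff_space G).
Context {m : {measure set (borel G) -> \bar R}} (hm : left_haar m).
Implicit Types (u v rho : G -> R) (C V : set G).

Let rm : radon m. Proof. by case: hm. Qed.

(** Otherwise the translates of V would be null sets, and finitely many of them
    cover any compact set; so compact sets, and by inner regularity the whole
    group, would be null.  The filter F consists of the families that contain
    all supersets of some null set. *)
Lemma haar_open_gt0 V : open V -> V 1%g -> (0 < m V)%E.
Proof.
move=> oV V1; rewrite lt0e measure_ge0 andbT; apply/eqP => mV0.
have [_ /eqP mT inv] := hm.
have mxV (x : G) : m [set (x * z)%g | z in V] = 0%E.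
  by rewrite mulg_imageE inv//; exact: open_borel.
apply: mT; have [_ _ ->] := rm; last exact: openT.
apply/eqP; rewrite eq_le; apply/andP; split; last first.
  by apply: ereal_sup_ubound; exists set0; [split; [exact: compact0|]|].
apply: ge_ereal_sup => _ [C [cC _] <-].
pose F := filter_from [set A : set (borel G) | measurable A /\ m A = 0%E]
  (fun A => [set B : set G | A `<=` B]).
have FF : Filter F.
  apply: filter_from_filter; first by exists set0.
  move=> A B [mA A0] [mB B0]; exists (A `|` B).
    split; first exact: measurableU.
    apply/eqP; rewrite eq_le measure_ge0 andbT.
    have : (m (A `|` B) <= m A + m B)%E by exact: measureU2.
    by rewrite A0 B0 adde0.
  by move=> W ABW; split=> x ?; apply: ABW; [left|right].
have [|A [mA A0] CA] := (compact_near_coveringP C).1 cC _ F (fun A x => A x) FF.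
  move=> x Cx; exists ([set (x * z)%g | z in V],
    [set B | [set (x * z)%g | z in V] `<=` B]).
    split.
      apply: open_nbhs_nbhs; split; first exact: open_mulg.
      by exists 1%g => //; rewrite mulg1.
    exists [set (x * z)%g | z in V] => //; split=> //.
    by apply: open_borel; exact: open_mulg.
  by move=> [y B] /= [Vy]; apply.
rewrite -A0; apply: le_measure; rewrite ?inE//; first exact: compact_borel.
exact: CA.
Qed.

Lemma approximate_identity (W : set G) : nbhs 1%g W ->
  exists rho, [/\ test_function rho, forall x, 0 <= rho x, supported_in W rho &
    (\int[m]_(x in setT) rho x = 1)%R].
Proof.
move=> W1.
have [phi [cphi phi01 [N [oN N1] phiN] [C cC [CW phiC]]]] :=
  bump_function (R := R) hlc hT2 W1.
have tphi : test_function phi by split=> //; exists C.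
have iphi := test_function_integrable hT2 rm tphi.
have mN : measurable (N : set (borel G)) by exact: open_borel.
have mC : measurable (C : set (borel G)) by exact: compact_borel.
have NC : N `<=` C.
  move=> x Nx; apply: contrapT => /phiC /eqP.
  by rewrite phiN// oner_eq0.
have mNoo : (m N < +oo)%E.
  apply: le_lt_trans (_ : (m C < +oo)%E); last by case: rm => + _ _; exact.
  by apply: le_measure; rewrite ?inE.
have i0 : 0 < (\int[m]_(x in setT) phi x)%R.
  have iN : m.-integrable setT (EFin \o \1_N : borel G -> \bar R).
    have : m.-integrable (N : set (borel G)) (EFin \o (fun=> 1)).
      by apply: (bounded_integrable (M := 1)) => // x _; rewrite normr1.
    move=> /(integrable_mkcond _ mN).1; congr (integrable _ _ _).
    apply/funext => x; rewrite /patch/= indicE.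
    by case: (x \in N).
  have : (\int[m]_(x in setT) \1_N x <= \int[m]_(x in setT) phi x)%R.
    apply: (le_Rintegral measurableT iN iphi) => x _; rewrite indicE.
    have [/set_mem/phiN ->//|_] := boolP (x \in N).
    by case/andP: (phi01 x).
  apply: lt_le_trans; rewrite /Rintegral integral_indic//= setIT.
  by rewrite fine_gt0// mNoo andbT haar_open_gt0.
exists (fun x => (\int[m]_(x in setT) phi x)%R^-1 * phi x); split.
- exact: test_functionZ.
- by move=> x; rewrite mulr_ge0 ?invr_ge0 ?(ltW i0)//; case/andP: (phi01 x).
- by move=> x nWx; rewrite phiC ?mulr0// => /CW.
- by rewrite (RintegralZl _ measurableT iphi) mulVf// gt_eqF.
Qed.

Definition Rconvolution u v : G -> R :=
  fun g => (\int[m]_(h in setT) (u h * v (h^-1 * g)%g))%R.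

Lemma translation_continuous v : continuous v ->
  continuous (fun hg : G * G => v (hg.1^-1 * hg.2)%g).
Proof.
move=> cv hg; apply: (@continuous_comp _ G _
  (fun hg : G * G => (hg.1^-1 * hg.2)%g) v); last exact: cv.
apply: (@continuous_comp _ (G * G)%type _
  (fun hg : G * G => (hg.1^-1%g, hg.2)) (fun p => (p.1 * p.2)%g)); last first.
  exact: mulg_continuous.
apply: cvg_pair; last exact: cvg_snd.
apply: (@continuous_comp _ G _ fst (fun x : G => x^-1%g)).
  exact: cvg_fst.
exact: invg_continuous.
Qed.

Lemma convolution_integrand_test rho v (g : G) : test_function rho ->
  continuous v -> test_function (fun h => rho h * v (h^-1 * g)%g).
Proof.
move=> [crho [C cC rhoC]] cv; split; last first.
  by exists C => // x /rhoC ->; rewrite mul0r.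
move=> h; apply: cvgM; first exact: crho.
apply: (@continuous_comp _ (G * G)%type _
  (fun h => (h, g)) (fun hg : G * G => v (hg.1^-1 * hg.2)%g)).
  by apply: cvg_pair => //; exact: cvg_cst.
exact: translation_continuous.
Qed.

Lemma mulg_compact (A B : set G) : compact A -> compact B ->
  compact [set (a * b)%g | a in A & b in B].
Proof.
move=> cA cB.
have -> : [set (a * b)%g | a in A & b in B] =
    (fun p : G * G => (p.1 * p.2)%g) @` (A `*` B).
  apply/seteqP; split=> [_ [a Aa [b Bb <-]]|_ [[a b] [Aa Bb] <-]].
    by exists (a, b).
  by exists a => //; exists b.
apply: continuous_compact; last exact: compact_setX.
by apply: continuous_subspaceT; exact: mulg_continuous.
Qed.

Lemma Rconvolution_supported (A B : set G) rho v : supported_in A rho ->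
  supported_in B v ->
  supported_in [set (a * b)%g | a in A & b in B] (Rconvolution rho v).
Proof.
move=> rhoA vB g nABg; rewrite /Rconvolution.
under eq_Rintegral => h _.
  rewrite (_ : _ * _ = 0); last first.
    have [Ah|/rhoA ->] := pselect (A h); last by rewrite mul0r.
    rewrite vB ?mulr0// => Bhg; apply: nABg.
    by exists h => //; exists (h^-1 * g)%g => //; rewrite mulVKg.
  over.
by rewrite Rintegral_cst// mul0r.
Qed.

Lemma Rconvolution_test rho v : test_function rho -> test_function v ->
  test_function (Rconvolution rho v).
Proof.
move=> trho tv; have [crho [A cA rhoA]] := trho; have [cv [B cB vB]] := tv.
split; last first.
  exists [set (a * b)%g | a in A & b in B]; first exact: mulg_compact.
  exact: Rconvolution_supported.
have irho := test_function_integrable hT2 rm trho.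
have [c c0 hc] : exists2 c, 0 < c & (\int[m]_(x in setT) `|rho x| <= c)%R.
  exists (`|(\int[m]_(x in setT) `|rho x|)%R| + 1); first by rewrite ltr_wpDl.
  by rewrite (le_trans (ler_norm _))// lerDl.
move=> g0; apply/cvgrPdist_le => e e0.
have ec0 : 0 < e / c by rewrite divr_gt0.
have cF : continuous (fun p : G * G => v (p.2^-1 * p.1)%g).
  move=> p; apply: (@continuous_comp _ (G * G)%type _ (fun p : G * G => (p.2, p.1))
    (fun hg : G * G => v (hg.1^-1 * hg.2)%g)).
    by apply: cvg_pair; [exact: cvg_snd|exact: cvg_fst].
  exact: translation_continuous.
apply: filterS (near_compact_uniform g0 cF cA ec0) => g /= hg.
have i1 g1 := test_function_integrable hT2 rm
  (convolution_integrand_test g1 trho cv).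
rewrite /Rconvolution -(RintegralB measurableT (i1 g0) (i1 g)).
have i2 : m.-integrable setT (EFin \o (fun h : borel G =>
    rho h * v (h^-1 * g0)%g - rho h * v (h^-1 * g)%g)).
  exact: (integrableB measurableT (i1 g0) (i1 g)).
have iabs : m.-integrable setT (EFin \o (fun h : borel G => `|rho h|)).
  exact: (integrable_norm irho).
have iabs2 : m.-integrable setT (EFin \o (fun h : borel G => e / c * `|rho h|)).
  exact: (integrableZl measurableT _ iabs).
apply: (le_trans (le_normr_Rintegral measurableT i2)).
apply: (@le_trans _ _ (\int[m]_(h in setT) (e / c * `|rho h|))%R).
  apply: (le_Rintegral measurableT (integrable_norm i2) iabs2) => h _.
  rewrite /= -mulrBr normrM mulrC.
  have [Ah|/rhoA ->] := pselect (A h); last by rewrite normr0 !mulr0.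
  by rewrite ler_wpM2r// ltW// hg.
rewrite (RintegralZl _ measurableT iabs).
by rewrite (le_trans (ler_wpM2l (ltW ec0) hc))// divfK ?gt_eqF.
Qed.

Lemma Rconvolution_ge0 rho v : (forall x, 0 <= rho x) -> (forall x, 0 <= v x) ->
  forall g, 0 <= Rconvolution rho v g.
Proof. by move=> r0 v0 g; apply: Rintegral_ge0 => x _; rewrite mulr_ge0. Qed.

Lemma Rconvolution_near rho v (W : set G) (e : R) (g : G) :
  test_function rho -> (forall x, 0 <= rho x) -> supported_in W rho ->
  (\int[m]_(x in setT) rho x = 1)%R -> continuous v ->
  (forall h, W h -> `|v (h^-1 * g)%g - v g| <= e) ->
  `|Rconvolution rho v g - v g| <= e.
Proof.
move=> trho r0 rhoW r1 cv hW.
have irho := test_function_integrable hT2 rm trho.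
have i1 := test_function_integrable hT2 rm (convolution_integrand_test g trho cv).
have i2 : m.-integrable setT (EFin \o (fun h : borel G => rho h * v g)).
  exact: (integrableZr measurableT _ irho).
have -> : v g = (\int[m]_(h in setT) (rho h * v g))%R.
  by rewrite (RintegralZr _ measurableT irho) r1 mul1r.
rewrite /Rconvolution -(RintegralB measurableT i1 i2).
have i3 := integrableB measurableT i1 i2.
have i4 : m.-integrable setT (EFin \o (fun h : borel G => e * rho h)).
  exact: (integrableZl measurableT _ irho).
apply: (le_trans (le_normr_Rintegral measurableT i3)).
rewrite (_ : e = (\int[m]_(h in setT) (e * rho h))%R); last first.
  by rewrite (RintegralZl _ measurableT irho) r1 mulr1.
apply: (le_Rintegral measurableT (integrable_norm i3) i4) => h _.
rewrite /= -mulrBr normrM mulrC (ger0_norm (r0 h)).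
have [Wh|/rhoW ->] := pselect (W h); last by rewrite !mulr0.
by rewrite ler_wpM2r// hW.
Qed.

(** Near 1 only the elements h of a compact neighbourhood N matter; both terms
    vanish when g lies outside the compact set N C. *)
Lemma test_function_uniform v (e : R) : test_function v -> 0 < e ->
  \forall h \near (1%g : G), forall g, `|v (h^-1 * g)%g - v g| <= e.
Proof.
move=> [cv [C cC vC]] e0.
have [N [cN _ N1 _]] :=
  locally_compact_nbhs hlc hT2 R (filterT : nbhs (1%g : G) setT).
have cNC := mulg_compact cN cC.
have := near_compact_uniform (1%g : G) (translation_continuous cv) cNC e0.
move=> /(filterI N1); apply: filterS => h [Nh /= hh] g.
have [NCg|nNCg] := pselect ([set (a * b)%g | a in N & b in C] g).
  by have := hh g NCg; rewrite invg1 mul1g distrC => /ltW.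
rewrite !vC ?subrr ?normr0 ?ltW// => [|hgC].
  move=> Cg; apply: nNCg; exists 1%g; first exact: nbhs_singleton.
  by exists g => //; rewrite mul1g.
by apply: nNCg; exists h => //; exists (h^-1 * g)%g => //; rewrite mulVKg.
Qed.

(** Convolutions are dense among test functions, but the topology to be used is
    not just uniform convergence, since the measures are infinite: the error
    must be dominated by a function whose integrals stay bounded along the
    sequence.  The convolution w below is that function; it is a convolution
    for the very reason that convergence of its integrals is then given. *)
Lemma weak_cvg_convolutions (gamma_ : nat -> {measure set (borel G) -> \bar R})
    (gamma : {measure set (borel G) -> \bar R}) :
  (forall n, radon (gamma_ n)) -> radon gamma ->
  (forall rho u, test_function rho -> test_function u ->
    (\int[gamma_ n]_(x in setT) Rconvolution rho u x)%R @[n --> \oo] -->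
    (\int[gamma]_(x in setT) Rconvolution rho u x)%R) ->
  forall u, test_function u ->
    (\int[gamma_ n]_(x in setT) u x)%R @[n --> \oo] -->
    (\int[gamma]_(x in setT) u x)%R.
Proof.
move=> rgamma_ rgamma cvgconv u tu.
have [cu [C cC uC]] := tu.
have [N [cN _ N1 _]] :=
  locally_compact_nbhs hlc hT2 R (filterT : nbhs (1%g : G) setT).
pose C' := [set (a * b)%g | a in N & b in C].
have cC' : compact C' by exact: mulg_compact.
have [v [tv v0 v1]] := test_function_ge1 (R := R) hlc hT2 cC'.
have h20 : 0 < 2^-1 :> R by rewrite invr_gt0.
have [rho0 [trho0 rho00 rho0W rho01]] :=
  approximate_identity (test_function_uniform tv h20).
pose w := Rconvolution rho0 v.
have tw : test_function w by exact: Rconvolution_test.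
have w0 g : 0 <= w g by exact: Rconvolution_ge0.
have w1 g : C' g -> 1 <= 2 * w g.
  move=> /v1 vg1.
  have : `|w g - v g| <= 2^-1.
    by apply: (Rconvolution_near trho0 rho00 rho0W rho01);
      [case: tv|move=> h; exact].
  by rewrite ler_norml => /andP[h1 h2]; lra.
pose B := (\int[gamma]_(x in setT) w x)%R + 1.
have B0 : 0 < B by rewrite ltr_wpDl// Rintegral_ge0.
apply/cvgrPdist_le => e e0.
(* From some n on B bounds the integrals of w, so that replacing u by rho * u
   costs at most e/3 in each integral. *)
pose d := e / 3 / (2 * B).
have d0 : 0 < d by rewrite !divr_gt0// mulr_gt0.
have [rho [trho rho_ge0 rhoW rhoint1]] :=
  approximate_identity (filterI N1 (test_function_uniform tu d0)).
pose z := Rconvolution rho u.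
have tz : test_function z by exact: Rconvolution_test.
have zu g : `|z g - u g| <= d * 2 * w g.
  have [C'g|nC'g] := pselect (C' g).
    apply: (@le_trans _ _ d).
      by apply: (Rconvolution_near trho rho_ge0 rhoW rhoint1 cu) => h [_]; exact.
    by rewrite -mulrA ler_peMr ?w1// ltW.
  rewrite /z (Rconvolution_supported rhoW uC); last first.
    by move=> [a [Na _] [b Cb ab]]; apply: nC'g; exists a => //; exists b.
  rewrite uC; last first.
    move=> Cg; apply: nC'g; exists 1%g; first exact: nbhs_singleton.
    by exists g => //; rewrite mul1g.
  by rewrite subrr normr0 mulr_ge0 ?w0// mulr_ge0// ltW.
have approx (nu : {measure set (borel G) -> \bar R}) : radon nu ->
    (`|\int[nu]_(x in setT) z x - \int[nu]_(x in setT) u x| <=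
      d * 2 * \int[nu]_(x in setT) w x)%R.
  move=> rnu.
  have iz := test_function_integrable hT2 rnu tz.
  have iu := test_function_integrable hT2 rnu tu.
  have iw := test_function_integrable hT2 rnu tw.
  have idw : nu.-integrable setT (EFin \o (fun h : borel G => d * 2 * w h)).
    exact: (integrableZl measurableT _ iw).
  have izu := integrableB measurableT iz iu.
  rewrite -(RintegralB measurableT iz iu) -(RintegralZl _ measurableT iw).
  apply: (le_trans (le_normr_Rintegral measurableT izu)).
  by apply: (le_Rintegral measurableT (integrable_norm izu) idw) => x _; exact: zu.
have dB : d * 2 * B = e / 3.
  by rewrite /d -mulrA divfK// gt_eqF// mulr_gt0.
have e30 : 0 < e / 3 by rewrite divr_gt0.
have /cvgrPdist_le/(_ _ e30) near_z := cvgconv rho u trho tu.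
have /cvgrPdist_le/(_ _ ltr01) near_w := cvgconv rho0 v trho0 tv.
apply: filterS (filterI near_z near_w) => n [hz hw].
have hB : (\int[gamma_ n]_(x in setT) w x)%R <= B.
  by move: hw; rewrite -/w ler_norml /B => /andP[h1 h2]; lra.
have a1 := approx _ rgamma.
have a2 := approx _ (rgamma_ n).
have b1 : d * 2 * (\int[gamma]_(x in setT) w x)%R <= e / 3.
  rewrite -dB; apply: ler_wpM2l; first by rewrite mulr_ge0// ltW.
  by rewrite /B lerDl.
have b2 : d * 2 * (\int[gamma_ n]_(x in setT) w x)%R <= e / 3.
  by rewrite -dB; apply: ler_wpM2l => //; rewrite mulr_ge0// ltW.
have := le_trans a1 b1; have := le_trans a2 b2; move: hz; rewrite -/z.
rewrite !ler_norml => /andP[? ?] /andP[? ?] /andP[? ?].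
by apply/andP; split; lra.
Qed.

End Haar.

(** * From complex to real functions *)

Section ComplexValued.
Context {R : realType}.
Local Open Scope complex_scope.

Lemma normc_ge_Im (z : R[i]) : `|complex.Im z|%:C <= `|z|.
Proof.
case: z => a b; rewrite normc_def lecR /= -sqrtr_sqr.
by rewrite ler_wsqrtr// lerDr sqr_ge0.
Qed.

Lemma le_normc_ReIm (z : R[i]) :
  `|z| <= (`|complex.Re z| + `|complex.Im z|)%:C.
Proof.
case: z => a b; rewrite normc_def lecR /=.
rewrite -[leRHS]ger0_norm ?addr_ge0// -sqrtr_sqr ler_wsqrtr//.
by rewrite sqrrD !real_normK ?num_real// addrAC lerDl -mulr_natr !mulr_ge0.
Qed.

Lemma cvg_ReIm {T : Type} {F : set_system T} {FF : Filter F} (f : T -> R[i])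
    (l : R[i]) :
  f @ F --> l <-> complex.Re (f x) @[x --> F] --> complex.Re l /\
    complex.Im (f x) @[x --> F] --> complex.Im l.
Proof.
split=> [fl|[fRe fIm]].
  have h (e : R) : 0 < e -> \forall x \near F, `|l - f x| < e%:C.
    by move=> e0; move/cvgrPdist_lt: fl; apply; rewrite ltcR.
  split; apply/cvgrPdist_lt => e e0; apply: filterS (h e e0) => x hx.
    rewrite -ltcR; apply: le_lt_trans hx.
    by have := normc_ge_Re (l - f x); rewrite raddfB.
  rewrite -ltcR; apply: le_lt_trans hx.
  by have := normc_ge_Im (l - f x); rewrite raddfB.
apply/cvgrPdist_lt => e e0.
have [eE e10] : e = (complex.Re e)%:C /\ 0 < complex.Re e.
  by case: e e0 => a b; rewrite ltcE /= => /andP[/eqP -> ?].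
have e20 : 0 < complex.Re e / 2 by rewrite divr_gt0.
have /cvgrPdist_lt/(_ _ e20) nRe := fRe.
have /cvgrPdist_lt/(_ _ e20) nIm := fIm.
apply: filterS (filterI nRe nIm) => x [hRe hIm].
rewrite (le_lt_trans (le_normc_ReIm _))// eE ltcR !raddfB/=.
by rewrite [ltRHS]splitr ltrD.
Qed.

Context {G : topologicalGroupType}.
Implicit Types (f : G -> R[i]) (u : G -> R).

Lemma Cc_test f : Cc f -> test_function (fun x => complex.Re (f x)) /\
  test_function (fun x => complex.Im (f x)).
Proof.
move=> [cf cC].
have cRI x : complex.Re (f y) @[y --> x] --> complex.Re (f x) /\
    complex.Im (f y) @[y --> x] --> complex.Im (f x).
  exact/(cvg_ReIm (F := nbhs x))/cf.
have f0 x : ~ closure [set x | f x != 0] x -> f x = 0.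
  move=> nx; apply: contrapT => /eqP fx; apply: nx.
  exact: subset_closure.
split; split.
- by move=> x; exact: (cRI x).1.
- by exists (closure [set x | f x != 0]) => // x /f0 ->.
- by move=> x; exact: (cRI x).2.
- by exists (closure [set x | f x != 0]) => // x /f0 ->.
Qed.

Lemma test_Cc u : hausdorff_space G -> test_function u ->
  Cc (fun x => (u x)%:C).
Proof.
move=> hT2 [cu [C cC uC]]; split.
  move=> x; apply/(cvg_ReIm (F := nbhs x)); split; first exact: cu.
  exact: cvg_cst.
have CC := compact_closed hT2 cC.
apply: (subclosed_compact _ cC); first exact: closed_closure.
rewrite [X in _ `<=` X](closure_id C).1//; apply: closureS => x /=.
by apply: contraNP => /uC ->.
Qed.

End ComplexValued.

Section Autocorrelation.
Context {R : realType} {G : topologicalGroupType}.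
Context (hT2 : hausdorff_space G).
Context {U K : set G} (oU : open U) (U1 : U 1%g).
Context {mG : {measure set (borel G) -> \bar R}}.
Local Open Scope complex_scope.
Implicit Types (u rho : G -> R).

Lemma periodization_real u (D : closed_subset G) : Del U K D ->
  test_function u ->
  periodization (fun x => (u x)%:C) D = (Rperiodization u D)%:C.
Proof.
move=> DelD [_ [C cC uC]]; rewrite (Rperiodization_restrict _ uC).
have -> : periodization (fun x => (u x)%:C) D =
    \sum_(x \in (D : set G) `&` C) (u x)%:C.
  apply/esym/fsbig_widen; first exact: subIsetl.
  by move=> x [Dx]; rewrite /= not_andE => -[//|/uC ->].
have fin := Del_finite oU U1 DelD cC.
by rewrite !fsbig_finite// rmorph_sum.
Qed.

Lemma test_functionV u : test_function u -> test_function (fun x => u x^-1%g).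
Proof.
move=> [cu [C cC uC]]; split.
  move=> x; apply: (@continuous_comp _ _ _ (fun x : G => x^-1%g) u).
    exact: invg_continuous.
  exact: cu.
exists [set x^-1%g | x in C].
  apply: continuous_compact => //; apply: continuous_subspaceT.
  exact: invg_continuous.
by move=> x nx; apply: uC => Cx; apply: nx; exists x^-1%g => //; rewrite invgK.
Qed.

(** The defining identity of gamma for [f1 g = rho g^-1] and [f2 = u], both real:
    then [star f1] is rho, and all the functions involved have zero imaginary
    part. *)
Lemma autocorrelation_real (Omega : IG U K)
    (mu : probability (borel (closed_subset G)) R)
    (gamma : {measure set (borel G) -> \bar R}) rho u :
  autocorrelation mG Omega mu gamma -> test_function rho -> test_function u ->
  (\int[gamma]_(x in setT) Rconvolution (m := mG) rho u x)%R =
  (\int[mu]_(D in carrier Omega)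
    (Rperiodization (fun x => rho x^-1%g) D * Rperiodization u D))%R.
Proof.
move=> [_ _ ac] trho tu.
have trhoV := test_functionV trho.
have := ac _ _ (test_Cc hT2 trhoV) (test_Cc hT2 tu).
move=> /(congr1 (@complex.Re R)) /= acRe.
transitivity (\int[gamma]_(x in setT) complex.Re
    (convolution mG (star (fun x => (rho x^-1%g)%:C)) (fun x => (u x)%:C) x))%R.
  apply: eq_Rintegral => g _; apply: eq_Rintegral => h _ /=.
  by rewrite invgK mulr0 subr0.
rewrite acRe; apply: eq_Rintegral => D /set_mem OD.
have DelD := carrier_Del OD.
rewrite (periodization_real DelD trhoV) (periodization_real DelD tu).
by rewrite conjc_real/= mulr0 subr0.
Qed.

End Autocorrelation.

(** * Convergence of the autocorrelations *)

Theorem corollary1 (R : realType) (G : topologicalGroupType)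
    (hlc : locally_compact [set: G]) (hsc : @second_countable G)
    (hT2 : hausdorff_space G) (huni : unimodular R G)
    (mG : {measure set (borel G) -> \bar R}) (hmG : left_haar mG)
    (U K : set G) (hU : open U) (hU1 : U 1%g) (hK : compact K)
    (Omega : IG U K) (mu : probability (borel (closed_subset G)) R)
    (hue : uniquely_ergodic R Omega) (hmu : invariant_probability Omega mu)
    (Omega_ : nat -> IG U K)
    (mu_ : nat -> probability (borel (closed_subset G)) R)
    (hmu_ : forall l, invariant_probability (Omega_ l) (mu_ l))
    (hcvg : Omega_ @ \oo --> Omega)
    (gamma : {measure set (borel G) -> \bar R})
    (hgamma : autocorrelation mG Omega mu gamma)
    (gamma_ : nat -> {measure set (borel G) -> \bar R})
    (hgamma_ : forall l, autocorrelation mG (Omega_ l) (mu_ l) (gamma_ l)) :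
  weak_star_cvg gamma_ gamma.
Proof.
have real_cvg (u : G -> R) : test_function u ->
    (\int[gamma_ n]_(x in setT) u x)%R @[n --> \oo] -->
    (\int[gamma]_(x in setT) u x)%R.
  apply: (weak_cvg_convolutions hlc hT2 hmG).
  - by move=> n; case: (hgamma_ n).
  - by case: hgamma.
  move=> rho v trho tv.
  rewrite (autocorrelation_real hT2 hU hU1 hgamma trho tv).
  under eq_fun do rewrite (autocorrelation_real hT2 hU hU1 (hgamma_ _) trho tv).
  apply: (Delone_cvg_Rintegral hlc hT2 hU hK hue hmu hmu_ hcvg).
  move=> D; apply: (@continuousM _ (subspace (Del U K))).
    apply: (Rperiodization_continuous (U := U) (K := K) hlc hT2 hU hU1).
    exact: test_functionV.
  exact: (Rperiodization_continuous (U := U) (K := K) hlc hT2 hU hU1).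
move=> f /Cc_test[tRe tIm]; apply/cvg_ReIm; split; exact: real_cvg.
Qed.
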